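(* Let $\lambda$ be a Borel measure on $\mathbb{R}^d$, let $\emptyset\neq\Omega\subseteq\mathbb{R}^d$ be open with $\lambda(\Omega)<\infty$, and let $K\in\mathcal{K}$ be $\lambda$-symmetric. Assume that the nonlocal Friedrichs inequality is satisfied in $V_0$. Then there is a constant $C>0$ such that for every $f\in L^2(\Omega,\lambda)$ the homogeneous nonlocal Dirichlet problem ($\mathcal{L}u=f$ in $\Omega$, $u=0$ in $\Gamma$) has a unique weak solution $u$, and $$\|u\|_V\le C\,\|f\|_{L^2(\Omega,\lambda)}.$$ In particular, $u$ depends continuously on $f\in L^2(\Omega,\lambda)$.
   Context: A transition kernel is a map $K:\mathbb{R}^d\times\mathcal{B}(\mathbb{R}^d)\to[0,\infty]$ ($\mathcal{B}(\mathbb{R}^d)$ the Borel $\sigma$-algebra) such that $K(x,\cdot)$ is a $\sigma$-finite measure for every $x$ and $K(\cdot,A)$ is Borel measurable for every $A$. It is non-degenerated if $x\mapsto\int f(x,y)\,K(x,\mathrm{d}y)$ is Borel measurable for every non-negative Borel measurable $f:\mathbb{R}^d\times\mathbb{R}^d\to\mathbb{R}$; $\mathcal{K}$ is the set of non-degenerated transition kernels. For a Borel measure $\lambda$, $K\in\mathcal{K}$ is $\lambda$-symmetric if $\lambda\otimes K=K\otimes\lambda$, where $(\lambda\otimes K)(M)=\int\int\chi_M(x,y)\,K(x,\mathrm{d}y)\,\mathrm{d}\lambda(x)$ and $(K\otimes\lambda)(M)=\int\int\chi_M(x,y)\,K(y,\mathrm{d}x)\,\mathrm{d}\lambda(y)$.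 $\Gamma=\{y\in\mathbb{R}^d\setminus\Omega: K(y,\Omega)>0\}$ and $\mathcal{L}u(x)=\operatorname{PV}\int_{\mathbb{R}^d}(u(x)-u(y))\,K(x,\mathrm{d}y)$. $\mathcal{V}$ is the space of Borel measurable $v:\mathbb{R}^d\to\mathbb{R}$ with $\|v\|_{\mathcal{V}}^2=\int_\Omega v^2\,\mathrm{d}\lambda+\int_\Omega\int_{\mathbb{R}^d}(v(x)-v(y))^2\,K(x,\mathrm{d}y)\,\mathrm{d}\lambda(x)<\infty$, and $\mathcal{V}_0=\{v\in\mathcal{V}: v=0\text{ on }\mathbb{R}^d\setminus\Omega\}$. $V$ and $V_0$ are the spaces of classes of elements of $\mathcal{V}$ and $\mathcal{V}_0$, respectively, modulo $\ker\|\cdot\|_{\mathcal{V}}=\{v\in\mathcal{V}: v=0\ \lambda\text{-a.e. on }\Omega\cup\Gamma\}$, with the induced norm $\|\cdot\|_V$. On $V$ set $$\mathcal{B}(u,v)=\tfrac12\int_\Omega\int_\Omega(u(x)-u(y))(v(x)-v(y))\,K(x,\mathrm{d}y)\,\mathrm{d}\lambda(x)+\int_\Omega\int_{\mathbb{R}^d\setminus\Omega}(u(x)-u(y))(v(x)-v(y))\,K(x,\mathrm{d}y)\,\mathrm{d}\lambda(x).$$ The nonlocal Friedrichs inequality holds in $V_0$ if there is $C>0$ with $\|v\|_{L^2(\Omega,\lambda)}^2\le C\,\mathcal{B}(v,v)$ for all $v\in V_0$. A weak solution of the homogeneous Dirichlet problem with datum $f$ is an element $u\in V_0$ such that $\mathcal{B}(u,v)=\int_\Omega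 f v\,\mathrm{d}\lambda$ for all $v\in V_0$. *)

(* Defs.v *)
From HB Require Import structures.
From mathcomp Require Import all_boot all_order all_algebra.
From mathcomp Require Import all_classical all_reals all_analysis.
From mathcomp Require Import measurable_realfun ring.

Set Implicit Arguments.
Unset Strict Implicit.
Unset Printing Implicit Defensive.
Import Order.TTheory GRing.Theory Num.Theory.
Import numFieldNormedType.Exports.
Local Open Scope classical_set_scope.
Local Open Scope ring_scope.
Local Open Scope quotient_scope.

Notation borel T := (g_sigma_algebraType (@open T%type)).

Lemma open_borel (T : ptopologicalType) (A : set T) :
  open A -> measurable (A : set (borel T)).
Proof. exact: sub_gen_smallest. Qed.

Lemma measurable_fun_borel (T : pointedType) (G : set (set T))
    (U : ptopologicalType) (f : T -> U) :
  (forall A, open A -> G (f @^-1` A)) ->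
  measurable_fun [set: g_sigma_algebraType G] (f : _ -> borel U).
Proof.
move=> Gf; apply: (@measurability _ _ (g_sigma_algebraType G) (borel U) setT f
  (@open U) erefl).
by move=> _ [A oA <-]; rewrite setTI; apply: sub_gen_smallest; exact: Gf.
Qed.

Section kernels.
Variables (R : realType) (d : nat).
Local Notation Rd := 'rV[R]_d.

(* Measurability of [f] is with respect to the Borel sets of the product space
   R^d x R^d, and [f] is real-valued, hence finite everywhere. *)
Definition nondegenerate_kernel (K : R.-sigmafker borel Rd ~> borel Rd) :=
  forall f : Rd * Rd -> R,
    (forall z, 0 <= f z) -> measurable_fun [set: borel (Rd * Rd)] f ->
    measurable_fun [set: borel Rd] (fun x => \int[K x]_y (f (x, y))%:E)%E.

Record ndkernel := NDKernel {
  ndkernel_kernel :> R.-sigmafker borel Rd ~> borel Rd ;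
  ndkernelP : nondegenerate_kernel ndkernel_kernel }.

Variables (lam : {measure set (borel Rd) -> \bar R}) (K : ndkernel).

Definition prod_left (M : set (borel (Rd * Rd))) : \bar R :=
  (\int[lam]_x \int[K x]_y (\1_M (x, y))%:E)%E.

Definition prod_right (M : set (borel (Rd * Rd))) : \bar R :=
  (\int[lam]_y \int[K y]_x (\1_M (x, y))%:E)%E.

Definition symmetric_kernel :=
  forall M, measurable M -> prod_left M = prod_right M.

End kernels.

Section function_spaces.
Variables (R : realType) (d : nat).
Local Notation Rd := 'rV[R]_d.
Variables (lam : {measure set (borel Rd) -> \bar R}) (K : ndkernel R d).
Variables (Om : set Rd) (oOm : open Om).

Definition normsq (v : Rd -> R) : \bar R :=
  (\int[lam]_(x in Om) (v x ^+ 2)%:E +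
   \int[lam]_(x in Om) \int[K x]_y ((v x - v y) ^+ 2)%:E)%E.

(* The proof [oOm] is an argument so that the closure of the space under linear
   combinations can be registered as a canonical instance. *)
Definition calV of open Om : {pred Rd -> R} :=
  [pred v | `[< measurable_fun [set: borel Rd] v /\ (normsq v < +oo)%E >]].

Let mOm : measurable (Om : set (borel Rd)) := open_borel oOm.

Let msq (v : Rd -> R) : measurable_fun [set: borel Rd] v ->
  measurable_fun (Om : set (borel Rd)) (fun x => (v x ^+ 2)%:E).
Proof.
move=> mv; apply: measurable_funTS; apply/measurable_EFinP.
exact: measurable_funX.
Qed.

Let mdiff (v : Rd -> R) : measurable_fun [set: borel Rd] v ->
  measurable_fun [set: borel (Rd * Rd)] (fun z : Rd * Rd => v z.1 - v z.2).
Proof.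
move=> mv; apply: measurable_funB.
  apply: (measurableT_comp mv).
  apply: (@measurable_fun_borel (Rd * Rd)%type _ Rd fst).
  by apply/continuousP => z; exact: cvg_fst.
apply: (measurableT_comp mv).
apply: (@measurable_fun_borel (Rd * Rd)%type _ Rd snd).
by apply/continuousP => z; exact: cvg_snd.
Qed.

Let mint (v : Rd -> R) : measurable_fun [set: borel Rd] v ->
  measurable_fun (Om : set (borel Rd))
    (fun x => \int[K x]_y ((v x - v y) ^+ 2)%:E)%E.
Proof.
move=> mv; apply: measurable_funTS.
apply: (@ndkernelP R d K (fun z => (v z.1 - v z.2) ^+ 2)) => [z|].
  exact: sqr_ge0.
by apply: measurable_funX; exact: mdiff.
Qed.

Let msec (v : Rd -> R) x : measurable_fun [set: borel Rd] v ->
  measurable_fun [set: borel Rd] (fun y => ((v x - v y) ^+ 2)%:E).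
Proof.
move=> mv; apply/measurable_EFinP; apply: measurable_funX.
exact: measurable_funB.
Qed.

Let s0 (t : R) : (0 <= (t ^+ 2)%:E)%E.
Proof. by rewrite lee_fin sqr_ge0. Qed.

Let i0 (v : Rd -> R) x : (0 <= \int[K x]_y ((v x - v y) ^+ 2)%:E)%E.
Proof. by apply: integral_ge0 => y _; exact: s0. Qed.

Let i1 (v : Rd -> R) : (0 <= \int[lam]_(x in Om) (v x ^+ 2)%:E)%E.
Proof. by apply: integral_ge0 => x _; exact: s0. Qed.

Let i2 (v : Rd -> R) :
  (0 <= \int[lam]_(x in Om) \int[K x]_y ((v x - v y) ^+ 2)%:E)%E.
Proof. by apply: integral_ge0 => x _; exact: i0. Qed.

Lemma normsq_ge0 v : (0 <= normsq v)%E.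
Proof. exact: adde_ge0 (i1 v) (i2 v). Qed.

Let z1 (v : Rd -> R) (k : R) : measurable_fun [set: borel Rd] v -> 0 <= k ->
  (\int[lam]_(x in Om) (k%:E * (v x ^+ 2)%:E) =
   k%:E * \int[lam]_(x in Om) (v x ^+ 2)%:E)%E.
Proof.
by move=> mv; exact: (ge0_integralZl_EFin lam mOm (fun x _ => s0 (v x)) (msq mv)).
Qed.

Let z0 (v : Rd -> R) (k : R) x : measurable_fun [set: borel Rd] v -> 0 <= k ->
  (\int[K x]_y (k%:E * ((v x - v y) ^+ 2)%:E) =
   k%:E * \int[K x]_y ((v x - v y) ^+ 2)%:E)%E.
Proof.
move=> mv.
exact: (ge0_integralZl_EFin (K x) measurableT (fun y _ => s0 (v x - v y)) (msec x mv)).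
Qed.

Let z2 (v : Rd -> R) (k : R) : measurable_fun [set: borel Rd] v -> 0 <= k ->
  (\int[lam]_(x in Om) (k%:E * \int[K x]_y ((v x - v y) ^+ 2)%:E) =
   k%:E * \int[lam]_(x in Om) \int[K x]_y ((v x - v y) ^+ 2)%:E)%E.
Proof.
by move=> mv; exact: (ge0_integralZl_EFin lam mOm (fun x _ => i0 v x) (mint mv)).
Qed.

Lemma normsqZ a (v : Rd -> R) : measurable_fun [set: borel Rd] v ->
  normsq (a *: v) = ((a ^+ 2)%:E * normsq v)%E.
Proof.
move=> mv; have a2 := sqr_ge0 a.
rewrite /normsq (ge0_muleDr _ (i1 v) (i2 v)) -z1// -z2//.
congr (_ + _)%E; apply: eq_integral => x _; first by rewrite -EFinM -exprMn.
by rewrite -z0//; apply: eq_integral => y _; rewrite -EFinM -exprMn mulrBr.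
Qed.

Let sqrD2 (a b : R) : (a + b) ^+ 2 <= 2 * (a ^+ 2) + 2 * (b ^+ 2).
Proof. by rewrite -subr_ge0 [leRHS](_ : _ = (a - b) ^+ 2) ?sqr_ge0//; ring. Qed.

Lemma normsqD (v w : Rd -> R) :
  measurable_fun [set: borel Rd] v -> measurable_fun [set: borel Rd] w ->
  (normsq (v + w)%R <= 2%:E * normsq v + 2%:E * normsq w)%E.
Proof.
move=> mv mw.
have mvw : measurable_fun [set: borel Rd] (v + w) by exact: measurable_funD.
have t0 (t : \bar R) : (0 <= t -> 0 <= 2%:E * t)%E.
  by move=> ?; apply: mule_ge0 => //; rewrite lee_fin.
have two : 0 <= 2 :> R by [].
rewrite /normsq (ge0_muleDr _ (i1 v) (i2 v)) (ge0_muleDr _ (i1 w) (i2 w)).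
rewrite [leRHS]addeACA -!z1// -!z2//; apply: leeD.
  have /= <- := (ge0_integralD lam mOm (fun x _ => t0 _ (s0 (v x)))
    (measurable_funeM _ (msq mv)) (fun x _ => t0 _ (s0 (w x)))
    (measurable_funeM _ (msq mw))).
  apply: (ge0_le_integral lam mOm (fun x _ => s0 _) (msq mvw)).
    by apply: emeasurable_funD; apply: measurable_funeM; exact: msq.
  by move=> x _; rewrite -!EFinM -EFinD lee_fin; exact: sqrD2.
have /= <- := (ge0_integralD lam mOm (fun x _ => t0 _ (i0 v x))
  (measurable_funeM _ (mint mv)) (fun x _ => t0 _ (i0 w x))
  (measurable_funeM _ (mint mw))).
apply: (ge0_le_integral lam mOm (fun x _ => i0 (v + w) x) (mint mvw)).
  by apply: emeasurable_funD; apply: measurable_funeM; exact: mint.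
move=> x _; rewrite -!z0//.
have /= <- := (ge0_integralD (K x) measurableT (fun y _ => t0 _ (s0 (v x - v y)))
  (measurable_funeM _ (msec x mv)) (fun y _ => t0 _ (s0 (w x - w y)))
  (measurable_funeM _ (msec x mw))).
apply: (ge0_le_integral (K x) measurableT (fun y _ => s0 _) (msec x mvw)).
  by apply: emeasurable_funD; apply: measurable_funeM; exact: msec.
move=> y _; rewrite -!EFinM -EFinD lee_fin.
by rewrite (_ : (v + w) x - (v + w) y = (v x - v y) + (w x - w y)) ?sqrD2//;
  rewrite opprD addrACA.
Qed.

Lemma normsq0 : normsq 0 = 0%E.
Proof.
rewrite /normsq !integral0_eq ?adde0// => x _; rewrite ?expr0n//.
by rewrite integral0_eq// => y _; rewrite subrr expr0n.
Qed.

Lemma calV_submod_closed : submod_closed (calV oOm).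
Proof.
split; first by rewrite inE; split; [exact: measurable_cst|rewrite normsq0].
move=> a v w; rewrite !inE => -[mv fv] [mw fw].
have mav : measurable_fun [set: borel Rd] (a *: v).
  exact: measurable_funM.
split; first exact: measurable_funD.
apply: le_lt_trans (normsqD mav mw) _.
by rewrite normsqZ// lte_add_pinfty// !lte_mul_pinfty ?lee_fin ?sqr_ge0//.
Qed.

HB.instance Definition _ :=
  GRing.isSubmodClosed.Build R (Rd -> R) (calV oOm) calV_submod_closed.

Record calVtype := CalV {
  calV_fun :> Rd -> R ;
  calV_funP : calV_fun \in calV oOm }.

HB.instance Definition _ := [isSub for calV_fun].
HB.instance Definition _ := [Choice of calVtype by <:].
HB.instance Definition _ := [SubChoice_isSubLmodule of calVtype by <:].

Definition kerV : {pred calVtype} := [pred v : calVtype | normsq v == 0%E].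

Lemma kerV_zmod_closed : zmod_closed kerV.
Proof.
split; first by rewrite inE normsq0.
move=> v w; rewrite !inE => /eqP v0 /eqP w0.
have /[!inE] -[mv _] := calV_funP v.
have /[!inE] -[mw _] := calV_funP w.
have mNw : measurable_fun [set: borel Rd] (-1 *: (w : Rd -> R)).
  exact: measurable_funM.
rewrite eq_le normsq_ge0 andbT.
have := normsqD mv mNw; rewrite normsqZ// v0 w0 !mule0 adde0.
by rewrite scaleN1r.
Qed.

HB.instance Definition _ :=
  GRing.isZmodClosed.Build calVtype kerV kerV_zmod_closed.

Definition Vspace := {ideal_quot kerV}.

(* Every quantity below depends on a class only, so it is evaluated at the
   representative chosen by [repr]. *)
Definition Vspace_fun (u : Vspace) : Rd -> R := repr u.
Coercion Vspace_fun : Vspace >-> Funclass.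

Definition normV (u : Vspace) : R := Num.sqrt (fine (normsq u)).

Definition calV0 : set calVtype := [set v | forall x, ~ Om x -> v x = 0].

Definition V0 : set Vspace := [set \pi_Vspace v | v in calV0].

Definition energy_form (u v : Vspace) : \bar R :=
  ((2^-1)%:E *
     \int[lam]_(x in Om) \int[K x]_(y in Om) ((u x - u y) * (v x - v y))%:E +
   \int[lam]_(x in Om) \int[K x]_(y in ~` Om) ((u x - u y) * (v x - v y))%:E)%E.

Definition nonlocal_friedrichs := exists2 C : R, 0 < C &
  forall v : Vspace, V0 v ->
    (\int[lam]_(x in Om) (v x ^+ 2)%:E <= C%:E * energy_form v v)%E.

(* L^2(Omega, lam), as the L^2 space over R^d of the measure lam restricted to
   Omega. *)
Definition L2 := LspaceType2 (mrestr lam (open_borel oOm)).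

Definition normL2 (f : Rd -> R) : R :=
  fine ('N[mrestr lam (open_borel oOm)]_2%:E[EFin \o f])%E.

Definition weak_solution (f : L2) (u : Vspace) := V0 u /\
  forall v : Vspace, V0 v ->
    energy_form u v = (\int[lam]_(x in Om) ((f x : R) * v x)%:E)%E.

End function_spaces.

(* Main.v *)
Require Import Defs.
From HB Require Import structures.
From mathcomp Require Import all_boot all_order all_algebra.
From mathcomp Require Import all_classical all_reals all_analysis.
From mathcomp Require Import measurable_realfun ring lra.

(** The energy form B is symmetric and positive semidefinite on V, and the
Friedrichs inequality makes it coercive on V_0: since B(v,v) dominates half of
the double integral over Omega x R^d in the norm,
[||v||^2 <= ||v||_{L^2(Omega)}^2 + 2 B(v,v) <= (C + 2) B(v,v)].  As
[v |-> \int_Omega f v] is bounded for B, the theorem is then the Riesz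
representation theorem for B on V_0, and testing the equation with the solution
itself gives [||u|| <= (C + 2) ||f||].  Uniqueness and continuity in f are this
estimate applied to a difference of two solutions.

Riesz representation ([psd_riesz]) is proved by minimising
[B(v,v) - 2 \int_Omega f v]: by the parallelogram identity a minimising sequence
is Cauchy at a geometric rate, and its limit solves the equation.  It is stated
for a semidefinite form on a set of functions, so that one can work with
functions instead of classes until the very end.

What remains is that V_0 is complete ([fin_norm0_complete]).  A fast Cauchy
sequence of functions vanishing outside Omega converges lambda-a.e. on Omega
([ae_cvg_fast], where lambda(Omega) < oo makes the L^2 rates summable in L^1), and
Fatou's lemma bounds both parts of the norm of the error.  The increments
v(x) - v(y) involve points y charged by K(x,.), so an exceptional lambda-null set
must also be K(x,.)-null for almost every x.  That is where symmetry enters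
([symmetric_kernel_null]): evaluating both sides of
[lambda (x) K = K (x) lambda] at R^d x N gives
[\int K(x,N) dlambda(x) = \int_N K(y,R^d) dlambda(y) = 0].

Iterated integrals are used throughout instead of a product measure, as lambda
is not assumed sigma-finite.  The function-space part is developed over an arbitrary
measurable space, for a family of measures K whose increment integrals are
measurable in x; on R^d this measurability is what non-degeneracy provides
([measurable_increment_integral]). *)

Set Implicit Arguments.
Unset Strict Implicit.
Unset Printing Implicit Defensive.
Import Order.TTheory GRing.Theory Num.Theory.
Import numFieldNormedType.Exports.
Local Open Scope classical_set_scope.
Local Open Scope ring_scope.

(** * Representation of functionals by semidefinite forms *)

(** The degenerate case [A = 0] forces [B = 0]: an affine function bounded below is
constant. *)
Lemma discriminant_le (R : realFieldType) (A B C : R) : 0 <= A ->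
  (forall k, 0 <= k ^+ 2 * A + 2 * k * B + C) -> B ^+ 2 <= A * C.
Proof.
move=> A0 q0; have [A00|An0] := eqVneq A 0.
  have C0 : 0 <= C by have := q0 0; rewrite A00; lra.
  have [->|Bn0] := eqVneq B 0; first by rewrite A00 expr0n/= mul0r.
  have := q0 (- (C + 1) / (2 * B)); rewrite A00 mulr0 add0r.
  have -> : 2 * (- (C + 1) / (2 * B)) * B = - (C + 1) by field.
  lra.
have Agt0 : 0 < A by rewrite lt_def An0.
have := q0 (- B / A).
have -> : (- B / A) ^+ 2 * A + 2 * (- B / A) * B + C = C - B ^+ 2 / A by field.
by rewrite subr_ge0 ler_pdivrMr// mulrC.
Qed.

Lemma le0_of_le_expr (R : realType) (t c : R) :
  (forall n, t <= c * 4^-1 ^+ n) -> t <= 0.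
Proof.
move=> tc.
have cvg0 : geometric c (4^-1 : R) @ \oo --> (0 : R).
  by apply: cvg_geometric; rewrite ger0_norm ?invr_ge0// invf_lt1// ltr1n.
have <- : limn (geometric c (4^-1 : R)) = 0 by exact: cvg_lim.
by apply: limr_ge; [apply/cvg_ex; exists 0|exact: nearW].
Qed.

(** The form is only required to behave well on W, so that a formula that makes
sense for all functions need not be restricted to a subtype of those for which
its integrals are finite. *)
Record psd_form (R : realType) (E : lmodType R) (W : set E) (a : E -> E -> R)
    : Prop := PsdForm {
  psd_lin : forall k u v, W u -> W v -> W (k *: u + v) ;
  psd_sym : forall u v, W u -> W v -> a u v = a v u ;
  psd_linear : forall k u v w, W u -> W v -> W w ->
    a u (k *: v + w) = k * a u v + a u w ;
  psd_ge0 : forall u, W u -> 0 <= a u u }.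

Section psd_form_theory.
Variables (R : realType) (E : lmodType R) (W : set E) (a : E -> E -> R).
Hypothesis psd : psd_form W a.

Lemma psd_sub u v : W u -> W v -> W (v - u).
Proof.
by move=> Wu Wv; rewrite addrC -scaleN1r; exact: (psd_lin psd).
Qed.

Lemma psd_linearl k u v w : W u -> W v -> W w ->
  a (k *: v + w) u = k * a v u + a w u.
Proof.
move=> Wu Wv Ww; have Wvw := psd_lin psd k Wv Ww.
by rewrite !(psd_sym psd _ Wu)// (psd_linear psd).
Qed.

Lemma psd_diffl u v w : W u -> W v -> W w -> a (v - w) u = a v u - a w u.
Proof.
by move=> Wu Wv Ww; rewrite addrC -scaleN1r psd_linearl// mulN1r addrC.
Qed.

Lemma psd_expand k u v : W u -> W v ->
  a (k *: u + v) (k *: u + v) = k ^+ 2 * a u u + 2 * k * a u v + a v v.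
Proof.
move=> Wu Wv; have Wuv := psd_lin psd k Wu Wv.
rewrite (psd_linear psd)// !psd_linearl// (psd_sym psd Wv Wu); ring.
Qed.

Lemma psd_cauchy_schwarz u v : W u -> W v -> a u v ^+ 2 <= a u u * a v v.
Proof.
move=> Wu Wv; apply: discriminant_le => [|k]; first exact: (psd_ge0 psd).
by rewrite -psd_expand//; apply: (psd_ge0 psd); exact: (psd_lin psd).
Qed.

Lemma psd_addl2 u v : W u -> W v -> a (u + v) (u + v) <= 2 * a u u + 2 * a v v.
Proof.
move=> Wu Wv; have := psd_expand 1 Wu Wv; have := psd_expand (-1) Wu Wv.
have := psd_ge0 psd (psd_lin psd (-1) Wu Wv).
by rewrite scale1r; lra.
Qed.

Lemma psd_null u v : W u -> W v -> a u u = 0 -> a u v = 0.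
Proof.
move=> Wu Wv u0; apply/eqP; rewrite -sqrf_eq0 eq_le sqr_ge0 andbT.
by rewrite (le_trans (psd_cauchy_schwarz Wu Wv))// u0 mul0r.
Qed.

(** Completeness is asked for sequences that are Cauchy at the rate [4^-n] only,
which is what a minimising sequence of [J v = a v v - 2 l v] delivers. *)
Lemma psd_riesz (l : E -> R) (M c : R) :
  W !=set0 -> 0 <= M ->
  (forall k u v, W u -> W v -> l (k *: u + v) = k * l u + l v) ->
  (forall v, W v -> l v ^+ 2 <= M * a v v) ->
  (forall u : nat -> E, (forall n, W (u n)) ->
     (forall n m, (n <= m)%N -> a (u m - u n) (u m - u n) <= 4^-1 ^+ n) ->
     exists2 w, W w & forall n, a (w - u n) (w - u n) <= c * 4^-1 ^+ n) ->
  exists2 u, W u & forall v, W v -> a u v = l v.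
Proof.
move=> [w0 Ww0] M_ge0 l_lin l_bd complete.
pose J v := a v v - 2 * l v.
pose S := J @` W.
have J_lb v : W v -> - M <= J v.
  move=> Wv; have av := psd_ge0 psd Wv; have lv := l_bd v Wv.
  rewrite leNgt; apply/negP; rewrite /J => Jlt.
  have : (a v v + M) ^+ 2 < (2 * l v) ^+ 2 by rewrite ltr_pXn2r ?nnegrE//; lra.
  have := sqr_ge0 (a v v - M); nra.
have infS : has_inf S.
  by split; [exists (J w0), w0|exists (- M) => _ [v Wv <-]; exact: J_lb].
have infJ v : W v -> inf S <= J v.
  by move=> Wv; apply: ge_inf; [case: infS|exists v].
have e_gt0 n : 0 < (4^-1 ^+ n : R) by rewrite exprn_gt0.
have /choice[u u_min] : forall n, exists v,
    W v /\ J v < inf S + 4^-1 * 4^-1 ^+ n.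
  move=> n; have [|_ [v Wv <-] ?] := @inf_adherent _ S (4^-1 * 4^-1 ^+ n) _ infS.
    by rewrite mulr_gt0.
  by exists v.
have Wu n : W (u n) by have [] := u_min n.
have u_cauchy n m : (n <= m)%N -> a (u m - u n) (u m - u n) <= 4^-1 ^+ n.
  move=> nm.
  pose d := u m - u n.
  have Wd : W d by exact: psd_sub.
  have umE : u m = 1 *: d + u n by rewrite scale1r subrK.
  (* parallelogram identity: J (u m) + J (u n) - 2 J (midpoint) = a d d / 2 *)
  have := infJ _ (psd_lin psd 2^-1 Wd (Wu n)).
  have [_] := u_min n; have [_] := u_min m.
  rewrite -/d umE /J !psd_expand// !l_lin//.
  have : (4^-1 : R) ^+ m <= 4^-1 ^+ n.
    by apply: ler_wiXn2l => //; rewrite invf_le1 ?ler1n.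
  have -> : (2^-1 : R) ^+ 2 = 4^-1 by field.
  have -> : 2 * 2^-1 = 1 :> R by field.
  set em := _ ^+ m; set en := _ ^+ n; lra.
have [w Ww uw] := complete u Wu u_cauchy.
exists w => // v Wv; apply/eqP; rewrite -subr_eq0 -sqrf_eq0 eq_le sqr_ge0 andbT.
apply: (@le0_of_le_expr _ _ (2 * a v v * (4^-1 + c))) => n.
have av := psd_ge0 psd Wv.
have near_l : (a v (u n) - l v) ^+ 2 <= a v v * (4^-1 * 4^-1 ^+ n).
  (* first-order condition for an almost minimiser: along every line through
     u n the quadratic polynomial J - inf S + 4^-n / 4 is nonnegative *)
  apply: discriminant_le => // k.
  have := infJ _ (psd_lin psd k Wv (Wu n)); have [_] := u_min n.
  rewrite /J psd_expand// l_lin//; lra.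
have near_w : (a w v - a (u n) v) ^+ 2 <= a v v * (c * 4^-1 ^+ n).
  rewrite -psd_diffl//.
  rewrite (le_trans (psd_cauchy_schwarz (psd_sub (Wu n) Ww) Wv))//.
  by rewrite mulrC ler_wpM2l.
move: near_l near_w; rewrite (psd_sym psd Wv)//.
set x := a (u n) v; set y := a w v; set z := l v; set e := _ ^+ n => ? ?.
have : (y - z) ^+ 2 <= 2 * (x - z) ^+ 2 + 2 * (y - x) ^+ 2.
  have := sqr_ge0 (x - z - (y - x)); nra.
nra.
Qed.

End psd_form_theory.

Lemma psd_add (R : realType) (E : lmodType R) (W : set E) (a b : E -> E -> R) :
  psd_form W a -> psd_form W b -> psd_form W (fun u v => a u v + b u v).
Proof.
move=> psda psdb; split.
- exact: (psd_lin psda).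
- by move=> u v Wu Wv; rewrite (psd_sym psda Wu Wv) (psd_sym psdb Wu Wv).
- move=> k u v w Wu Wv Ww.
  rewrite (psd_linear psda k Wu Wv Ww) (psd_linear psdb k Wu Wv Ww); ring.
- move=> u Wu; apply: addr_ge0; first exact: (psd_ge0 psda).
  exact: (psd_ge0 psdb).
Qed.

Lemma psd_scale (R : realType) (E : lmodType R) (W : set E) (a : E -> E -> R)
    (c : R) : 0 <= c -> psd_form W a -> psd_form W (fun u v => c * a u v).
Proof.
move=> c0 psda; split.
- exact: (psd_lin psda).
- by move=> u v Wu Wv; rewrite (psd_sym psda Wu Wv).
- by move=> k u v w Wu Wv Ww; rewrite (psd_linear psda k Wu Wv Ww); ring.
- by move=> u Wu; apply: mulr_ge0 => //; exact: (psd_ge0 psda).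
Qed.

Lemma psd_restrict (R : realType) (E : lmodType R) (V W : set E)
    (a : E -> E -> R) : V `<=` W ->
  (forall k u v, V u -> V v -> V (k *: u + v)) ->
  psd_form W a -> psd_form V a.
Proof.
move=> VW V_lin psda; split.
- exact: V_lin.
- by move=> u v Vu Vv; apply: (psd_sym psda); exact: VW.
- by move=> k u v w Vu Vv Vw; apply: (psd_linear psda); exact: VW.
- by move=> u Vu; apply: (psd_ge0 psda); exact: VW.
Qed.

(** * Square-integrable functions *)

Section mul_integrable.
Context d (X : measurableType d) (R : realType).
Variables (mu : {measure set X -> \bar R}) (D : set X).
Hypothesis mD : measurable D.

Lemma integrable_mul_sqr (f g : X -> R) :
  measurable_fun D f -> measurable_fun D g ->
  (\int[mu]_(x in D) (f x * f x)%:E < +oo)%E ->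
  (\int[mu]_(x in D) (g x * g x)%:E < +oo)%E ->
  mu.-integrable D (fun x => (f x * g x)%:E).
Proof.
move=> mf mg f2 g2.
have sqr_integrable (h : X -> R) : measurable_fun D h ->
    (\int[mu]_(x in D) (h x * h x)%:E < +oo)%E ->
    mu.-integrable D (fun x => (h x * h x)%:E).
  move=> mh h2; apply/integrableP; split.
    by apply/measurable_EFinP; exact: measurable_funM.
  rewrite (le_lt_trans _ h2)// le_eqVlt; apply/orP; left; apply/eqP.
  by apply: eq_integral => x _; rewrite gee0_abs// lee_fin -expr2 sqr_ge0.
apply: (le_integrable mD _ _
  (integrableD mD (sqr_integrable f mf f2) (sqr_integrable g mg g2))).
  by apply/measurable_EFinP; exact: measurable_funM.
move=> x _; rewrite /= lee_fin.
rewrite [leRHS]ger0_norm ?addr_ge0 -?expr2 ?sqr_ge0// normrM.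
rewrite -(real_normK (num_real (f x))) -(real_normK (num_real (g x))).
have := sqr_ge0 (`|f x| - `|g x|); have := normr_ge0 (f x).
have := normr_ge0 (g x); nra.
Qed.

End mul_integrable.

Section square_integrable.
Context d (X : measurableType d) (R : realType).
Variables (mu : {measure set X -> \bar R}) (D : set X).
Hypothesis mD : measurable D.
Implicit Types u v w : X -> R.

(** Measurability is on the whole space while integrability is on D only: values
outside Omega matter for the nonlocal part of the norm. *)
Record sqr_int u : Prop := SqrInt {
  sqr_int_measurable : measurable_fun [set: X] u ;
  sqr_int_lty : (\int[mu]_(x in D) (u x ^+ 2)%:E < +oo)%E }.

Definition ip u v : R := fine (\int[mu]_(x in D) (u x * v x)%:E)%E.

Lemma integrable_ip u v : sqr_int u -> sqr_int v ->
  mu.-integrable D (fun x => (u x * v x)%:E).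
Proof.
by move=> [mu1 u2] [mv v2]; apply: (integrable_mul_sqr mD);
  try exact: measurable_funTS; [exact: u2|exact: v2].
Qed.

Lemma ipE u v : sqr_int u -> sqr_int v ->
  (\int[mu]_(x in D) (u x * v x)%:E = (ip u v)%:E)%E.
Proof.
move=> uL vL; rewrite fineK//; apply: integrable_fin_num => //.
exact: integrable_ip.
Qed.

Lemma ip_sqrE u : sqr_int u ->
  (\int[mu]_(x in D) (u x ^+ 2)%:E = (ip u u)%:E)%E.
Proof. by move=> uL; rewrite -ipE. Qed.

Lemma sqr_int_lin (k : R) u v : sqr_int u -> sqr_int v -> sqr_int (k *: u + v).
Proof.
move=> uL vL; have [mu1 u2] := uL; have [mv v2] := vL.
have mkuv : measurable_fun setT (k *: u + v).
  by apply: measurable_funD => //; exact: measurable_funM.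
split=> //.
have uu := integrable_ip uL uL; have vv := integrable_ip vL vL.
have := integrable_lty mD
  (integrableD mD (integrableZl mD (2 * k ^+ 2) uu) (integrableZl mD 2 vv)).
apply: le_lt_trans; apply: ge0_le_integral => //.
- by move=> x _; rewrite lee_fin sqr_ge0.
- by apply: measurable_funTS; apply/measurable_EFinP; exact: measurable_funX.
- exact: (measurable_int mu (integrableD mD (integrableZl mD (2 * k ^+ 2) uu)
    (integrableZl mD 2 vv))).
move=> x _; rewrite /= lee_fin -[(k *: u + v) x]/(k * u x + v x).
have := sqr_ge0 (k * u x - v x); nra.
Qed.

Lemma ip_psd : psd_form sqr_int ip.
Proof.
split.
- exact: sqr_int_lin.
- by move=> u v _ _; congr fine; apply: eq_integral => x _; rewrite mulrC.
- move=> k u v w uL vL wL; apply: EFin_inj.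
  rewrite EFinD EFinM -!ipE//; last exact: sqr_int_lin.
  have uv := integrable_ip uL vL; have uw := integrable_ip uL wL.
  rewrite -integralZl// -integralD//; last exact: integrableZl.
  apply: eq_integral => x _ /=; rewrite -EFinM -EFinD; congr EFin.
  rewrite -[(k *: v + w) x]/(k * v x + w x); ring.
- move=> u uL; apply: fine_ge0; apply: integral_ge0 => x _.
  by rewrite lee_fin -expr2 sqr_ge0.
Qed.

End square_integrable.

Section restricted_norm.
Context d (X : measurableType d) (R : realType).
Variables (mu : {measure set X -> \bar R}) (D : set X) (mD : measurable D).

Lemma ge0_integral_mrestr (f : X -> \bar R) : measurable_fun setT f ->
  (forall x, 0 <= f x)%E ->
  (\int[mrestr mu mD]_x f x = \int[mu]_(x in D) f x)%E.
Proof.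
move=> mf f0; have mCD := measurableC mD.
have mf' E : measurable_fun E f by exact: measurable_funTS.
have CD0 : mrestr mu mD (~` D) = 0%E by rewrite /mrestr setICl measure0.
rewrite -(setUv D) (ge0_integral_setU (mrestr mu mD) mD mCD (mf' _))//; last first.
  by rewrite disj_set2E setICr.
rewrite (null_set_integral mCD (mf' _) CD0) adde0.
apply: eq_measure_integral => A mA AD.
by rewrite /= /mrestr setIidl.
Qed.

(** The library norm on the restricted measure is turned into an integral over D,
so that one inner product [ip] serves both the datum and the solution. *)
Lemma Lnorm2_mrestr (f : X -> R) : measurable_fun setT f ->
  (('N[mrestr mu mD]_2%:E[EFin \o f]) =
   (\int[mu]_(x in D) (f x ^+ 2)%:E) `^ 2^-1)%E.
Proof.
move=> mf; rewrite unlock; congr (_ `^ _)%E.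
rewrite -ge0_integral_mrestr.
- apply: eq_integral => x _ /=; rewrite powR_mulrn//.
  by rewrite real_normK// num_real.
- by apply/measurable_EFinP; exact: measurable_funX.
- by move=> x; rewrite lee_fin sqr_ge0.
Qed.

Lemma finite_Lnorm2_sqr_int (f : X -> R) : measurable_fun setT f ->
  ('N[mrestr mu mD]_2%:E[EFin \o f] < +oo)%E -> sqr_int mu D f.
Proof.
move=> mf; rewrite Lnorm2_mrestr// => fN; split=> //.
by apply: lty_poweRy fN.
Qed.

Lemma fine_Lnorm2_mrestr (f : X -> R) : sqr_int mu D f ->
  fine ('N[mrestr mu mD]_2%:E[EFin \o f])%E = Num.sqrt (ip mu D f f).
Proof.
move=> fL; have [mf _] := fL; rewrite Lnorm2_mrestr// ip_sqrE//=.
by rewrite -powR12_sqrt// (psd_ge0 (ip_psd mu mD) fL).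
Qed.

End restricted_norm.

(** * Almost everywhere convergence of fast Cauchy sequences *)

(** The n-th partial sum is at most [2 A (1 - 2^-n)]. *)
Lemma nneseries_half_lty (R : realType) (a : nat -> R) (A : R) : 0 <= A ->
  (forall n, 0 <= a n <= A * 2^-1 ^+ n) -> (\sum_(n <oo) (a n)%:E < +oo)%E.
Proof.
move=> A0 aA; apply: (@le_lt_trans _ _ (2 * A)%:E); last exact: ltry.
apply: lime_le.
  by apply: is_cvg_nneseries => n _ _; have /andP[] := aA n; rewrite lee_fin.
apply: nearW => n; rewrite sumEFin lee_fin.
apply: (@le_trans _ _ (2 * A * (1 - 2^-1 ^+ n))); last first.
  by rewrite ler_piMr ?mulr_ge0// gerBl exprn_ge0.
elim: n => [|n IH]; first by rewrite big_nil expr0 subrr mulr0.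
rewrite big_nat_recr//= exprS.
have /andP[_] := aA n; move: IH; set e := _ ^+ n; lra.
Qed.

(** The weighted inequality [t <= 2^n t^2 + 2^-n] turns the L^2 rate [4^-n] of the
increments into the L^1 rate [(c + mu D) 2^-n]; hence the sum of the increments is
integrable, thus finite a.e., and the sequence converges absolutely there. *)
Lemma ae_cvg_fast d (X : measurableType d) (R : realType)
    (mu : {measure set X -> \bar R}) (D : set X) (u : (X -> R)^nat) (c : R) :
  measurable D -> (mu D < +oo)%E -> 0 <= c ->
  (forall n, measurable_fun setT (u n)) ->
  (forall n, (\int[mu]_(x in D) ((u n.+1 x - u n x) ^+ 2)%:E
     <= (c * 4^-1 ^+ n)%:E)%E) ->
  exists G, [/\ measurable G, G `<=` D, mu (D `\` G) = 0%E &
    forall x, G x -> cvgn (u ^~ x)].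
Proof.
move=> mD muD c0 mu1 uc.
pose t n x := `|u n.+1 x - u n x|.
have mt n : measurable_fun D (fun x => (t n x)%:E).
  apply: measurable_funTS; apply/measurable_EFinP; apply: measurableT_comp => //.
  exact: measurable_funB.
have t0 n x : D x -> (0 <= (t n x)%:E)%E by move=> _; rewrite lee_fin normr_ge0.
pose h x := (\sum_(n <oo) (t n x)%:E)%E.
have mh : measurable_fun D h.
  by apply: (ge0_emeasurable_sum (P := xpredT)) => n *; [exact: t0|exact: mt].
have h0 x : (0 <= h x)%E.
  by apply: nneseries_ge0 => n _ _; rewrite lee_fin normr_ge0.
have muDfin : mu D \is a fin_num by rewrite ge0_fin_numE.
pose L := fine (mu D).
have L0 : 0 <= L by exact: fine_ge0.
have it n : (\int[mu]_(x in D) (t n x)%:E <= ((c + L) * 2^-1 ^+ n)%:E)%E.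
  have mw : measurable_fun setT (fun x => (u n.+1 x - u n x) ^+ 2).
    by apply: measurable_funX; exact: measurable_funB.
  have := uc n; set w := fun x => (u n.+1 x - u n x) ^+ 2 in mw *.
  have mw' : measurable_fun D (fun x => (w x)%:E).
    by apply: measurable_funTS; exact/measurable_EFinP.
  have w0 x : 0 <= w x by exact: sqr_ge0.
  have p0 : 0 <= (2 ^+ n : R) by exact: exprn_ge0.
  have q0 : 0 <= (2^-1 ^+ n : R) by exact: exprn_ge0.
  have pq : 2 ^+ n * 2^-1 ^+ n = 1 :> R by rewrite -exprMn mulfV// expr1n.
  move=> iw.
  apply: (@le_trans _ _ (\int[mu]_(x in D)
      ((2 ^+ n)%:E * (w x)%:E + (2^-1 ^+ n)%:E))%E).
    apply: ge0_le_integral => //.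
    - exact: t0.
    - by apply: emeasurable_funD => //; exact: measurable_funeM.
    move=> x _; rewrite -EFinM -EFinD lee_fin /w.
    rewrite -(real_normK (num_real _)) -/(t n x).
    have : 0 <= t n x by rewrite normr_ge0.
    (* expand the nonnegative 2^-n (2^n t - 1)^2 *)
    move: pq p0 q0; set p := 2 ^+ n; set q := _ ^+ n; set s := t n x.
    move=> pq p0 q0 s0.
    have : 0 <= q * (p * s - 1) ^+ 2 by apply: mulr_ge0 => //; exact: sqr_ge0.
    have -> : q * (p * s - 1) ^+ 2 =
      (p * q) * p * s ^+ 2 - 2 * (p * q) * s + q by ring.
    rewrite pq; lra.
  rewrite ge0_integralD//; last 2 first.
  - by move=> x _; rewrite -EFinM lee_fin mulr_ge0.
  - exact: measurable_funeM.
  rewrite ge0_integralZl_EFin// ?integral_cst//; last by move=> x _; rewrite lee_fin.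
  rewrite -(fineK muDfin) -EFinM -/L.
  apply: (@le_trans _ _ ((2 ^+ n)%:E * (c * 4^-1 ^+ n)%:E + (2^-1 ^+ n * L)%:E)%E).
    by rewrite leeD2r// lee_wpmul2l// lee_fin.
  rewrite -EFinM -EFinD lee_fin.
  have -> : (4^-1 : R) ^+ n = 2^-1 ^+ n * 2^-1 ^+ n.
    by rewrite -exprMn; congr (_ ^+ _); field.
  have -> : 2 ^+ n * (c * (2^-1 ^+ n * 2^-1 ^+ n)) =
    (2 ^+ n * 2^-1 ^+ n) * c * 2^-1 ^+ n :> R by ring.
  by rewrite pq mul1r mulrDl (mulrC L).
have ih : mu.-integrable D h.
  apply/integrableP; split => //.
  under eq_integral do rewrite gee0_abs//.
  rewrite /h integral_nneseries//.
  have itfin n : (\int[mu]_(x in D) (t n x)%:E)%E \is a fin_num.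
    rewrite ge0_fin_numE; first exact: le_lt_trans (it n) (ltry _).
    by apply: integral_ge0; exact: t0.
  under eq_eseriesr do rewrite -(fineK (itfin _)).
  apply: (@nneseries_half_lty _ _ (c + L)); first exact: addr_ge0.
  move=> n; rewrite fine_ge0/=; last by apply: integral_ge0; exact: t0.
  by rewrite -lee_fin fineK.
exists (D `&` [set x | h x \is a fin_num]); split.
- exact: emeasurable_fin_num.
- by move=> x [].
- apply/negligibleP; first by apply: measurableD => //; exact: emeasurable_fin_num.
  apply: negligibleS (integrable_ae mD ih).
  by move=> x [Dx] /not_andP[//|hx] /= /(_ Dx).
move=> x [Dx /= hx].
have ct : cvgn (series (fun n => t n x)).
  apply: nnseries_is_cvg => //.
    by move=> n; rewrite normr_ge0.
  by move: hx; rewrite ge0_fin_numE.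
have : cvgn (series (telescope (u ^~ x))).
  by apply: (@normed_cvg _ R^o); exact: ct.
rewrite telescopeK => cu.
have -> : u ^~ x = (fun n => (u n x - u 0%N x) + u 0%N x).
  by apply/funext => n; rewrite subrK.
by apply: is_cvgD => //; exact: is_cvg_cst.
Qed.

(** * The increment form *)

Lemma limn_einf_le_near (R : realType) (a : (\bar R)^nat) (x B : \bar R) :
  (x <= limn_einf a)%E -> (\forall n \near \oo, (a n <= B)%E) -> (x <= B)%E.
Proof.
move=> xa aB; rewrite (le_trans xa)// limn_einf_lim.
apply: lime_le; first exact: is_cvg_einfs.
apply: filterS aB => n; apply: le_trans.
by apply: ereal_inf_lbound; exists n => /=.
Qed.

Lemma fatou_cvg d (X : measurableType d) (R : realType)
    (mu : {measure set X -> \bar R}) (D : set X) (f : (X -> \bar R)^nat)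
    (g : X -> \bar R) : measurable D ->
  (forall n, measurable_fun D (f n)) -> (forall n x, D x -> 0 <= f n x)%E ->
  (forall x, D x -> f n x @[n --> \oo] --> g x) ->
  (\int[mu]_(x in D) g x <= limn_einf (fun n => \int[mu]_(x in D) f n x))%E.
Proof.
move=> mD mf f0 fg; apply: le_trans (fatou mu mD mf f0).
rewrite le_eqVlt; apply/orP; left; apply/eqP; apply: eq_integral => x.
by rewrite inE => Dx; have [->] := cvg_limn_einf_sup (fg x Dx).
Qed.

Section nonlocal_form.
Context d (X : measurableType d) (R : realType).
Variables (lam : {measure set X -> \bar R}) (K : X -> {measure set X -> \bar R}).
Variables (Om : set X) (mOm : measurable Om).
Hypothesis mK : forall (u v : X -> R) (D : set X),
  measurable_fun setT u -> measurable_fun setT v -> measurable D ->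
  measurable_fun setT
    (fun x => \int[K x]_(y in D) ((u x - u y) * (v x - v y))%:E)%E.
Implicit Types (u v w : X -> R) (D : set X).

Local Notation inner D u v x :=
  (\int[K x]_(y in D) ((u x - u y) * (v x - v y))%:E)%E.

(** Omega x D is the domain of integration: D = Omega, its complement and the
whole space give the two parts of the energy and the seminorm. *)
Definition increment_form D u v : \bar R := (\int[lam]_(x in Om) inner D u v x)%E.

Record fin_energy u : Prop := FinEnergy {
  fin_energy_measurable : measurable_fun [set: X] u ;
  fin_energy_lty : (increment_form [set: X] u u < +oo)%E }.

Let sq_ge0 (t : R) : (0 <= (t * t)%:E)%E.
Proof. by rewrite lee_fin -expr2 sqr_ge0. Qed.

Let minc u v x : measurable_fun setT u -> measurable_fun setT v ->
  measurable_fun setT (fun y => ((u x - u y) * (v x - v y))%:E).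
Proof.
move=> mu mv; apply/measurable_EFinP.
by apply: measurable_funM; exact: measurable_funB.
Qed.

Lemma increment_formC D u v : increment_form D u v = increment_form D v u.
Proof.
apply: eq_integral => x _; apply: eq_integral => y _.
by rewrite mulrC.
Qed.

Lemma increment_form_ge0 D u : (0 <= increment_form D u u)%E.
Proof. by do 2!(apply: integral_ge0 => ? _). Qed.

Lemma increment_form_setU u : measurable_fun setT u ->
  forall D, measurable D ->
  increment_form setT u u = (increment_form D u u + increment_form (~` D) u u)%E.
Proof.
move=> mu D mD; have mCD := measurableC mD.
rewrite /increment_form -ge0_integralD//; first last.
- exact/measurable_funTS/mK.
- by move=> x _; exact: integral_ge0.
- exact/measurable_funTS/mK.
- by move=> x _; exact: integral_ge0.
apply: eq_integral => x _.
rewrite -(setUv D) ge0_integral_setU//.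
  by apply: measurable_funTS; exact: minc.
by rewrite disj_set2E setICr.
Qed.

Lemma increment_form_le D u : measurable D -> measurable_fun setT u ->
  (increment_form D u u <= increment_form setT u u)%E.
Proof.
by move=> mD mu; rewrite (increment_form_setU mu mD) leeDl ?increment_form_ge0.
Qed.

Lemma integrable_inner_sqr D u : measurable D -> fin_energy u ->
  lam.-integrable Om (fun x => inner D u u x).
Proof.
move=> mD [mu uE]; apply/integrableP; split; first exact/measurable_funTS/mK.
apply: le_lt_trans uE; apply: (le_trans _ (increment_form_le mD mu)).
rewrite le_eqVlt; apply/orP; left; apply/eqP; apply: eq_integral => x _.
by rewrite gee0_abs//; exact: integral_ge0.
Qed.

(** Bilinearity of the iterated integral can fail at points x where the inner
integral diverges; this confines the failure to a lambda-null set. *)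
Lemma ae_integrable_increment D u v : measurable D ->
  fin_energy u -> fin_energy v ->
  \forall x \ae lam, Om x ->
    (K x).-integrable D (fun y => ((u x - u y) * (v x - v y))%:E).
Proof.
move=> mD.
have ae_fin w : fin_energy w -> \forall x \ae lam, Om x ->
    (inner D w w x < +oo)%E.
  move=> wE; have intw := integrable_inner_sqr mD wE.
  apply: filterS (integrable_ae mOm intw) => x + Omx => /(_ Omx) h.
  by rewrite -ge0_fin_numE//; exact: integral_ge0.
move=> uE vE; have [mu _] := uE; have [mv _] := vE.
apply: filterS2 (ae_fin _ uE) (ae_fin _ vE) => x ux vx Omx.
apply: (integrable_mul_sqr mD); try exact/measurable_funTS/measurable_funB.
  exact: ux.
exact: vx.
Qed.

Lemma integrable_inner D u v : measurable D -> fin_energy u -> fin_energy v ->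
  lam.-integrable Om (fun x => inner D u v x).
Proof.
move=> mD uE vE; have [mu _] := uE; have [mv _] := vE.
apply: (le_integrable mOm _ _
  (integrableD mOm (integrable_inner_sqr mD uE) (integrable_inner_sqr mD vE))).
  exact/measurable_funTS/mK.
move=> x _ /=.
have i0 w : (0 <= inner D w w x)%E by exact: integral_ge0.
rewrite [leRHS](gee0_abs (adde_ge0 (i0 u) (i0 v))).
rewrite -(ge0_integralD (K x) mD); [|by []| |by []|]; first last.
- exact/measurable_funTS/minc.
- exact/measurable_funTS/minc.
apply: (le_trans (le_abse_integral _ mD _)); first exact/measurable_funTS/minc.
apply: ge0_le_integral => //.
- by apply: measurableT_comp => //; exact/measurable_funTS/minc.
- by apply: emeasurable_funD; exact/measurable_funTS/minc.
move=> y _; rewrite -EFinD lee_fin normrM.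
set s := u x - u y; set t := v x - v y.
rewrite -!expr2 -(real_normK (num_real s)) -(real_normK (num_real t)).
have := sqr_ge0 (`|s| - `|t|); have := normr_ge0 s.
have := normr_ge0 t; nra.
Qed.

Lemma increment_form_fin_num D u v : measurable D -> fin_energy u -> fin_energy v ->
  increment_form D u v \is a fin_num.
Proof.
by move=> mD uE vE; apply: integrable_fin_num => //; exact: integrable_inner.
Qed.

Lemma increment_form_linear D u v w (k : R) : measurable D ->
  fin_energy u -> fin_energy v -> fin_energy w ->
  increment_form D u (k *: v + w) =
  (k%:E * increment_form D u v + increment_form D u w)%E.
Proof.
move=> mD uE vE wE.
have [mu _] := uE; have [mv _] := vE; have [mw _] := wE.
have muv := integrable_inner mD uE vE; have muw := integrable_inner mD uE wE.
have mkvw : measurable_fun setT (k *: v + w).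
  by apply: measurable_funD => //; exact: measurable_funM.
rewrite -integralZl//.
have mkuv := integrableZl mOm k muv.
transitivity (\int[lam]_(x in Om) (k%:E * inner D u v x + inner D u w x))%E;
  last exact: integralD.
apply: ae_eq_integral => //.
- exact/measurable_funTS/mK.
- by apply: emeasurable_funD; [exact: (measurable_int lam mkuv)
                              |exact: (measurable_int lam muw)].
apply: filterS2 (ae_integrable_increment mD uE vE)
  (ae_integrable_increment mD uE wE) => x uv uw Omx.
rewrite -integralZl//; last exact: uv.
rewrite -integralD//; [|exact: (integrableZl mD k (uv Omx))|exact: uw].
apply: eq_integral => y _ /=.
rewrite -EFinM -EFinD; congr EFin.
rewrite -[(k *: v + w) x]/(k * v x + w x) -[(k *: v + w) y]/(k * v y + w y).
ring.
Qed.

Lemma increment_formD_le u v : fin_energy u -> fin_energy v ->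
  (increment_form setT (u + v)%R (u + v)%R <=
   2%:E * increment_form setT u u + 2%:E * increment_form setT v v)%E.
Proof.
move=> uE vE; have [mu _] := uE; have [mv _] := vE.
have iu := integrable_inner measurableT uE uE.
have iv := integrable_inner measurableT vE vE.
have i2u := integrableZl mOm 2 iu; have i2v := integrableZl mOm 2 iv.
rewrite -!integralZl// -integralD//; apply: ge0_le_integral => //.
- move=> x _; apply: integral_ge0 => y _.
  by rewrite lee_fin -expr2 sqr_ge0.
- by apply: measurable_funTS; apply: mK => //; exact: measurable_funD.
- exact: (measurable_int lam (integrableD mOm i2u i2v)).
move=> x _.
have md w : measurable_fun setT w -> measurable_fun setT
    (fun y => ((w x - w y) * (w x - w y))%:E).
  move=> mw; apply/measurable_EFinP.
  by apply: measurable_funM; exact: measurable_funB.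
have mud := md _ mu; have mvd := md _ mv.
rewrite -!ge0_integralZl_EFin// -ge0_integralD//; first last.
- exact: measurable_funeM.
- by move=> y _; rewrite mule_ge0// lee_fin.
- exact: measurable_funeM.
- by move=> y _; rewrite mule_ge0// lee_fin.
apply: ge0_le_integral => //.
- exact/md/measurable_funD.
- by apply: emeasurable_funD; exact: measurable_funeM.
move=> y _; rewrite -!EFinM -EFinD lee_fin.
rewrite -[(u + v) x]/(u x + v x) -[(u + v) y]/(u y + v y).
have := sqr_ge0 ((u x - u y) - (v x - v y)); nra.
Qed.

Lemma increment_formZ (k : R) u : measurable_fun setT u ->
  increment_form setT (k *: u) (k *: u) = ((k ^+ 2)%:E * increment_form setT u u)%E.
Proof.
move=> mu; have k2 := sqr_ge0 k.
have i0 x : Om x -> (0 <= inner setT u u x)%E by move=> _; exact: integral_ge0.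
have mi := measurable_funTS (D := Om) (mK mu mu measurableT).
rewrite -(ge0_integralZl_EFin lam mOm i0 mi k2).
apply: eq_integral => x _.
have s0 y : setT y -> (0 <= ((u x - u y) * (u x - u y))%:E)%E by [].
rewrite -(ge0_integralZl_EFin (K x) measurableT s0 (minc x mu mu) k2).
apply: eq_integral => y _; rewrite -EFinM; congr EFin.
rewrite -[(k *: u) x]/(k * u x) -[(k *: u) y]/(k * u y); ring.
Qed.

Lemma fin_energy_lin (k : R) u v :
  fin_energy u -> fin_energy v -> fin_energy (k *: u + v).
Proof.
move=> [mu uE] vE; have [mv vlty] := vE.
have kuE : fin_energy (k *: u).
  split; first exact: measurable_funM.
  have k2 : (0 <= (k ^+ 2)%:E :> \bar R)%E by rewrite lee_fin sqr_ge0.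
  by rewrite (increment_formZ k mu); exact: (lte_mul_pinfty k2 erefl uE).
split; first exact: measurable_funD (fin_energy_measurable kuE) mv.
apply: le_lt_trans (increment_formD_le kuE vE) _.
have two : (0 <= 2%:E :> \bar R)%E by rewrite lee_fin.
apply: lte_add_pinfty.
  exact: (lte_mul_pinfty two erefl (fin_energy_lty kuE)).
exact: (lte_mul_pinfty two erefl vlty).
Qed.

Definition rincrement_form D u v : R := fine (increment_form D u v).

Lemma rincrement_formE D u v : measurable D -> fin_energy u -> fin_energy v ->
  increment_form D u v = (rincrement_form D u v)%:E.
Proof. by move=> mD uE vE; rewrite fineK//; exact: increment_form_fin_num. Qed.

Lemma rincrement_form_psd D : measurable D -> psd_form fin_energy (rincrement_form D).
Proof.
move=> mD; split.
- exact: fin_energy_lin.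
- by move=> u v _ _; rewrite /rincrement_form increment_formC.
- move=> k u v w uE vE wE; apply: EFin_inj.
  rewrite -(rincrement_formE mD uE (fin_energy_lin k vE wE)).
  rewrite (increment_form_linear _ mD uE vE wE).
  by rewrite (rincrement_formE mD uE vE) (rincrement_formE mD uE wE).
- by move=> u _; apply: fine_ge0; exact: increment_form_ge0.
Qed.

Lemma rincrement_form_setU D u : measurable D -> fin_energy u ->
  rincrement_form setT u u = rincrement_form D u u + rincrement_form (~` D) u u.
Proof.
move=> mD uE; have mCD := measurableC mD; apply: EFin_inj.
rewrite -(rincrement_formE measurableT uE uE).
rewrite (increment_form_setU (fin_energy_measurable uE) mD).
by rewrite (rincrement_formE mD uE uE) (rincrement_formE mCD uE uE).
Qed.

Lemma integral_sqr_cvg_le (v : (X -> R)^nat) u (B : \bar R) :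
  (forall n, measurable_fun setT (v n)) ->
  (forall x, v n x @[n --> \oo] --> u x) ->
  (\forall n \near \oo, \int[lam]_(x in Om) (v n x ^+ 2)%:E <= B)%E ->
  (\int[lam]_(x in Om) (u x ^+ 2)%:E <= B)%E.
Proof.
move=> mv vu; apply: limn_einf_le_near.
apply: fatou_cvg => // [n|n x _|x _].
- apply: measurable_funTS; apply/measurable_EFinP; exact: measurable_funX.
- by rewrite lee_fin sqr_ge0.
- by apply: cvg_EFin; [exact: nearW|exact: cvgM].
Qed.

(** Fatou's lemma is used twice, for the inner and for the outer integral. *)
Lemma increment_form_cvg_le D (v : (X -> R)^nat) u (B : \bar R) : measurable D ->
  (forall n, measurable_fun setT (v n)) ->
  (forall x, v n x @[n --> \oo] --> u x) ->
  (\forall n \near \oo, increment_form D (v n) (v n) <= B)%E ->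
  (increment_form D u u <= B)%E.
Proof.
move=> mD mv vu; apply: limn_einf_le_near.
have mu : measurable_fun setT u by exact: (measurable_fun_cvg mv (fun x _ => vu x)).
apply: (@le_trans _ _
  (\int[lam]_(x in Om) limn_einf (fun n => inner D (v n) (v n) x))%E).
  apply: ge0_le_integral => //.
  - by move=> x _; exact: integral_ge0.
  - exact/measurable_funTS/mK.
  - have -> : (fun x => limn_einf (fun n => inner D (v n) (v n) x)) =
      (fun x => - limn_esup (fun n => - inner D (v n) (v n) x))%E by [].
    apply: measurableT_comp => //; apply: measurable_fun_limn_esup => n.
    by apply: measurableT_comp => //; exact/measurable_funTS/mK.
  move=> x _; apply: fatou_cvg => // [n|y _].
    exact/measurable_funTS/minc.
  by apply: cvg_EFin; [exact: nearW|apply: cvgM; exact: cvgB].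
apply: fatou => // [n|n x _]; last exact: integral_ge0.
exact/measurable_funTS/mK.
Qed.

(** For x outside N the inner integral only sees [u y] with y in N, a set that
K(x,.) does not charge; the points x of N itself are lambda-negligible. *)
Lemma increment_form_null (N : set X) u : measurable N -> measurable_fun setT u ->
  lam N = 0%E -> (\forall x \ae lam, Om x -> K x N = 0%E) ->
  (forall x, ~ N x -> u x = 0) -> increment_form setT u u = 0%E.
Proof.
move=> mN mu N0 KN0 u0.
have mN' : measurable (~` N) by exact: measurableC.
suff -> : (increment_form setT u u = \int[lam]_(x in Om) 0)%E.
  by rewrite integral0.
apply: ae_eq_integral => //; first exact/measurable_funTS/mK.
have : \forall x \ae lam, ~ N x by exists N; split => // x /= /contrapT.
apply: filterS2 KN0 => x KN0 Nx Omx.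
rewrite (u0 _ Nx).
rewrite (ge0_negligible_integral mN)//; last 2 first.
- by have := minc x mu mu; rewrite (u0 _ Nx).
- exact: KN0.
apply: integral0_eq => y [_ /u0 ->].
by rewrite subr0 mulr0.
Qed.

End nonlocal_form.

(** * The energy space and its completeness *)

Section energy_space.
Context d (X : measurableType d) (R : realType).
Variables (lam : {measure set X -> \bar R}) (K : X -> {measure set X -> \bar R}).
Variables (Om : set X) (mOm : measurable Om).
Hypothesis mK : forall (u v : X -> R) (D : set X),
  measurable_fun setT u -> measurable_fun setT v -> measurable D ->
  measurable_fun setT
    (fun x => \int[K x]_(y in D) ((u x - u y) * (v x - v y))%:E)%E.
Implicit Types u v w : X -> R.

Let mCOm : measurable (~` Om) := measurableC mOm.
Local Notation form := (increment_form lam K Om).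

Definition sqnorm v : \bar R :=
  (\int[lam]_(x in Om) (v x ^+ 2)%:E + form setT v v)%E.

(** A record rather than a conjunction, so that the predicate at two different
functions is told apart without unfolding integrals. *)
Record fin_norm v : Prop := FinNorm {
  fin_norm_measurable : measurable_fun [set: X] v ;
  fin_norm_lty : (sqnorm v < +oo)%E }.

Let int_sqr_ge0 v : (0 <= \int[lam]_(x in Om) (v x ^+ 2)%:E)%E.
Proof. by apply: integral_ge0 => x _; rewrite lee_fin sqr_ge0. Qed.

Lemma fin_norm_sqr_int v : fin_norm v -> sqr_int lam Om v.
Proof.
move=> [mv vfin]; split=> //; apply: le_lt_trans vfin.
by rewrite /sqnorm leeDl// increment_form_ge0.
Qed.

Lemma fin_norm_energy v : fin_norm v -> fin_energy lam K Om v.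
Proof.
move=> [mv vfin]; split=> //; apply: le_lt_trans vfin.
by rewrite /sqnorm leeDr.
Qed.

Definition norm_form u v : R := ip lam Om u v + rincrement_form lam K Om setT u v.

Lemma sqnormE v : fin_norm v -> sqnorm v = (norm_form v v)%:E.
Proof.
move=> vV; rewrite /norm_form EFinD -(ip_sqrE mOm (fin_norm_sqr_int vV)).
have vE := fin_norm_energy vV.
by rewrite -(rincrement_formE mOm mK measurableT vE vE).
Qed.

Lemma fin_norm_lin (k : R) u v :
  fin_norm u -> fin_norm v -> fin_norm (k *: u + v).
Proof.
move=> uV vV.
have [m2 l2] := sqr_int_lin mOm k (fin_norm_sqr_int uV) (fin_norm_sqr_int vV).
have [_ e2] := fin_energy_lin mOm mK k (fin_norm_energy uV) (fin_norm_energy vV).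
by split => //; exact: lte_add_pinfty.
Qed.

Definition energy u v : R :=
  2^-1 * rincrement_form lam K Om Om u v + rincrement_form lam K Om (~` Om) u v.

Lemma norm_form_psd : psd_form fin_norm norm_form.
Proof.
apply: (psd_add (a := ip lam Om) (b := rincrement_form lam K Om setT)).
- exact: (psd_restrict fin_norm_sqr_int fin_norm_lin (ip_psd lam mOm)).
- exact: (psd_restrict fin_norm_energy fin_norm_lin
    (rincrement_form_psd lam mOm mK measurableT)).
Qed.

Lemma energy_psd : psd_form fin_norm energy.
Proof.
have half : 0 <= 2^-1 :> R by rewrite invr_ge0.
apply: (psd_add (a := fun u v => 2^-1 * rincrement_form lam K Om Om u v)
  (b := rincrement_form lam K Om (~` Om))).
- apply: (psd_scale half).
  exact: (psd_restrict fin_norm_energy fin_norm_lin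
    (rincrement_form_psd lam mOm mK mOm)).
- exact: (psd_restrict fin_norm_energy fin_norm_lin
    (rincrement_form_psd lam mOm mK mCOm)).
Qed.

Lemma energyE u v : fin_norm u -> fin_norm v ->
  ((2^-1)%:E * form Om u v + form (~` Om) u v = (energy u v)%:E)%E.
Proof.
move=> /fin_norm_energy uE /fin_norm_energy vE.
by rewrite (rincrement_formE mOm mK mOm uE vE) (rincrement_formE mOm mK mCOm uE vE).
Qed.

(** The energy counts Omega x Omega with weight 1/2, whence the factor 2. *)
Lemma energy_le_sqnorm v : fin_norm v ->
  energy v v <= norm_form v v <= ip lam Om v v + 2 * energy v v.
Proof.
move=> vV; have vE := fin_norm_energy vV.
rewrite /energy /norm_form (rincrement_form_setU mOm mK mOm vE).
have := psd_ge0 (rincrement_form_psd lam mOm mK mOm) vE.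
have := psd_ge0 (rincrement_form_psd lam mOm mK mCOm) vE.
have := psd_ge0 (ip_psd lam mOm) (fin_norm_sqr_int vV).
set p := ip _ _ _ _; set q := rincrement_form _ _ _ _ _ _.
set r := rincrement_form _ _ _ _ _ _.
by move=> *; apply/andP; split; lra.
Qed.

Lemma sqnormD v w : fin_norm v -> fin_norm w ->
  (sqnorm (v + w)%R <= 2%:E * sqnorm v + 2%:E * sqnorm w)%E.
Proof.
move=> vV wV; have vwV := fin_norm_lin 1 vV wV.
rewrite scale1r in vwV; rewrite (sqnormE vV) (sqnormE wV) (sqnormE vwV).
by rewrite -!EFinM -EFinD lee_fin; exact: (psd_addl2 norm_form_psd vV wV).
Qed.

Lemma sqnorm0_energy z v : fin_norm z -> fin_norm v -> sqnorm z = 0%E ->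
  energy z v = 0.
Proof.
move=> zV vV z0; apply: (psd_null energy_psd zV vV).
have /andP[ez _] := energy_le_sqnorm zV.
have rz0 : norm_form z z = 0 by apply: EFin_inj; rewrite -(sqnormE zV).
apply/eqP; rewrite eq_le (psd_ge0 energy_psd zV) andbT.
by rewrite (le_trans ez)// rz0.
Qed.

Lemma ip_le_norm_form v : fin_norm v -> ip lam Om v v <= norm_form v v.
Proof.
move=> vV; rewrite /norm_form lerDl.
exact: (psd_ge0 (rincrement_form_psd lam mOm mK measurableT) (fin_norm_energy vV)).
Qed.

Lemma sqnorm0_ip f z : fin_norm z -> sqr_int lam Om f -> sqnorm z = 0%E ->
  ip lam Om z f = 0.
Proof.
move=> zV fL z0; have zL := fin_norm_sqr_int zV.
apply: (psd_null (ip_psd lam mOm) zL fL).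
have rz0 : norm_form z z = 0 by apply: EFin_inj; rewrite -(sqnormE zV).
apply/eqP; rewrite eq_le (psd_ge0 (ip_psd lam mOm) zL) andbT.
by rewrite (le_trans (ip_le_norm_form zV))// rz0.
Qed.

(** The energy depends on classes only, by the Cauchy-Schwarz inequality. *)
Lemma energy_congr u u' v v' :
  fin_norm u -> fin_norm u' -> fin_norm v -> fin_norm v' ->
  sqnorm (u - u') = 0%E -> sqnorm (v - v') = 0%E -> energy u v = energy u' v'.
Proof.
move=> uV uV' vV vV' uu vv.
have left w w' z : fin_norm w -> fin_norm w' -> fin_norm z ->
    sqnorm (w - w') = 0%E -> energy w z = energy w' z.
  move=> wV wV' zV ww; apply/eqP; rewrite -subr_eq0 -(psd_diffl energy_psd)//.
  by rewrite (sqnorm0_energy (psd_sub energy_psd wV' wV) zV ww).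
rewrite (left _ _ _ uV uV' vV uu) (psd_sym energy_psd uV' vV).
by rewrite (left _ _ _ vV vV' uV' vv) (psd_sym energy_psd vV' uV').
Qed.

Lemma ip_congr f v v' : sqr_int lam Om f -> fin_norm v -> fin_norm v' ->
  sqnorm (v - v') = 0%E -> ip lam Om f v = ip lam Om f v'.
Proof.
move=> fL vV vV' vv.
have vL := fin_norm_sqr_int vV; have vL' := fin_norm_sqr_int vV'.
rewrite (psd_sym (ip_psd lam mOm) fL vL) (psd_sym (ip_psd lam mOm) fL vL').
apply/eqP; rewrite -subr_eq0 -(psd_diffl (ip_psd lam mOm))//.
by rewrite (sqnorm0_ip (psd_sub energy_psd vV' vV) fL vv).
Qed.

(** Testing with w itself:
[||w||^2 <= (C + 2) B(w,w) = (C + 2) \int f w <= (C + 2) ||f|| ||w||]. *)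
Lemma energy_estimate (C : R) f w : 0 <= C -> sqr_int lam Om f -> fin_norm w ->
  ip lam Om w w <= C * energy w w -> energy w w = ip lam Om f w ->
  Num.sqrt (norm_form w w) <= (C + 2) * Num.sqrt (ip lam Om f f).
Proof.
move=> C0 fL wV friedrichs eq.
have /andP[_ le1] := energy_le_sqnorm wV.
have le2 := psd_cauchy_schwarz (ip_psd lam mOm) fL (fin_norm_sqr_int wV).
have le3 := ip_le_norm_form wV.
have ff0 := psd_ge0 (ip_psd lam mOm) fL.
have ww0 := psd_ge0 norm_form_psd wV.
rewrite eq in friedrichs le1; move: friedrichs le1 le2 le3 ff0 ww0.
set p := ip _ _ w w; set q := ip _ _ f w; set r := norm_form w w.
set s := ip _ _ f f => pq rp qs pr s0 r0.
have [->|rn0] := eqVneq r 0.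
  by rewrite sqrtr0 mulr_ge0 ?addr_ge0 ?sqrtr_ge0.
have sr0 : 0 < Num.sqrt r by rewrite sqrtr_gt0 lt_def rn0.
rewrite -(ler_pM2r sr0) -expr2 (sqr_sqrtr r0) -mulrA -(sqrtrM _ s0).
have q_le : q <= Num.sqrt (s * r).
  rewrite (le_trans (ler_norm q))// -sqrtr_sqr ler_wsqrtr//.
  by rewrite (le_trans qs)// ler_wpM2l.
have : (C + 2) * q <= (C + 2) * Num.sqrt (s * r).
  by rewrite ler_wpM2l// addr_ge0.
apply: le_trans; rewrite mulrDl.
by rewrite (le_trans rp)// lerD2r.
Qed.

Hypothesis K_null : forall N, measurable N -> lam N = 0%E ->
  \forall x \ae lam, K x N = 0%E.
Hypothesis lamOm : (lam Om < +oo)%E.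

Lemma sqnorm_null (N : set X) v : measurable N ->
  measurable_fun [set: X] v -> lam N = 0%E ->
  (forall x, ~ N x -> v x = 0) -> sqnorm v = 0%E.
Proof.
move=> mN mv N0 v0; rewrite /sqnorm.
rewrite (increment_form_null mOm mK mN mv N0)//; last first.
  by apply: filterS (K_null mN N0).
rewrite adde0 (ge0_negligible_integral mN)//.
- by apply: integral0_eq => x [_ /v0 ->]; rewrite expr0n.
- by apply: measurable_funTS; apply/measurable_EFinP; exact: measurable_funX.
- by move=> x _; rewrite lee_fin sqr_ge0.
Qed.

Definition fin_norm0 : set (X -> R) :=
  [set v | fin_norm v /\ forall x, ~ Om x -> v x = 0].

(** Replacing each [u n] by its product [v n] with the indicator of the
convergence set G changes it on a null set only, and makes the sequence converge
at every point, so that Fatou's lemma applies with no exceptional set in either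
variable.  The constant 8 comes from [sqnormD] applied twice, and from bounding
the two parts of the norm separately. *)
Lemma fin_norm0_complete (u : nat -> X -> R) (c : R) : 0 <= c ->
  (forall n, fin_norm0 (u n)) ->
  (forall n m, (n <= m)%N -> sqnorm (u m - u n)%R <= (c * 4^-1 ^+ n)%:E)%E ->
  exists2 w, fin_norm0 w &
    forall n, (sqnorm (w - u n)%R <= (8 * c * 4^-1 ^+ n)%:E)%E.
Proof.
move=> c0 u0 uc.
have uV n : fin_norm (u n) by have [] := u0 n.
have mu n : measurable_fun [set: X] (u n) by have [] := uV n.
have [G [mG GOm G0 Gcvg]] : exists G : set X,
    [/\ measurable G, G `<=` Om, lam (Om `\` G) = 0%E &
    forall x, G x -> cvgn (u ^~ x)].
  apply: (ae_cvg_fast mOm lamOm c0 mu) => n.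
  apply: le_trans (uc n n.+1 (leqnSn n)).
  by rewrite /sqnorm leeDl// increment_form_ge0.
have mN : measurable (Om `\` G : set X) by exact: measurableD.
have mI : measurable_fun [set: X] (\1_G : X -> R).
  exact: measurable_indic.
pose v n : X -> R := fun x => u n x * \1_G x.
have mv n : measurable_fun [set: X] (v n) by exact: measurable_funM.
have null (z : X -> R) : measurable_fun [set: X] z ->
    (forall x, ~ Om x \/ G x -> z x = 0) -> sqnorm z = 0%E.
  move=> mz z0; apply: (sqnorm_null mN mz G0) => x /not_andP[nOm|].
    by apply: z0; left.
  by move/contrapT => Gx; apply: z0; right.
have nullV (z : X -> R) : measurable_fun [set: X] z ->
    sqnorm z = 0%E -> fin_norm z by move=> mz z0; split => //; rewrite z0 ltry.
have vG n x : G x -> v n x = u n x by move=> Gx; rewrite /v indicE mem_set// mulr1.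
have uOm n x : ~ Om x -> u n x = 0 by have [_] := u0 n; apply.
have vOm n x : ~ Om x -> v n x = 0 by move=> /uOm; rewrite /v => ->; rewrite mul0r.
have vcvg x : cvgn (v ^~ x).
  have [Gx|nGx] := pselect (G x).
    have -> : v ^~ x = u ^~ x by apply/funext => n; rewrite vG.
    exact: Gcvg.
  have -> : v ^~ x = fun=> 0.
    by apply/funext => n; rewrite /v indicE memNset// mulr0.
  exact: is_cvg_cst.
pose w x : R := limn (v ^~ x).
have mw : measurable_fun [set: X] w.
  exact: (measurable_fun_cvg mv (fun x _ => vcvg x)).
have wOm x : ~ Om x -> w x = 0.
  move=> nOm; rewrite /w; have -> : v ^~ x = fun=> 0.
    by apply/funext => n; rewrite vOm.
  exact: lim_cst.
have vv n m : (n <= m)%N -> (sqnorm (v m - v n)%R <= (2 * c * 4^-1 ^+ n)%:E)%E.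
  move=> nm.
  have -> : v m - v n = (u m - u n) + ((u n - v n) - (u m - v m)).
    by apply/funext => x; rewrite !fctE /=; ring.
  have mz : measurable_fun [set: X] ((u n - v n) - (u m - v m)).
    by do 2!apply: measurable_funB => //.
  have z0 : sqnorm ((u n - v n) - (u m - v m)) = 0%E.
    apply: null => // x [nOm|Gx]; rewrite !fctE /=.
      by rewrite !uOm ?vOm// !subrr.
    by rewrite !vG// !subrr.
  apply: (le_trans (sqnormD (psd_sub norm_form_psd (uV n) (uV m)) (nullV _ mz z0))).
  by rewrite z0 mule0 adde0 -mulrA EFinM lee_wpmul2l// ?lee_fin// uc.
have vw n : (sqnorm (w - v n)%R <= (4 * c * 4^-1 ^+ n)%:E)%E.
  have md m : measurable_fun [set: X] (v m - v n) by exact: measurable_funB.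
  have cvgd x : (v m - v n) x @[m --> \oo] --> (w - v n) x.
    apply: cvgB; first exact: vcvg.
    exact: cvg_cst.
  have -> : 4 * c * 4^-1 ^+ n = 2 * c * 4^-1 ^+ n + 2 * c * 4^-1 ^+ n by ring.
  rewrite EFinD /sqnorm; apply: leeD.
    apply: (integral_sqr_cvg_le mOm md cvgd).
    exists n => // m /= nm; apply: le_trans (vv n m nm).
    by rewrite /sqnorm leeDl// increment_form_ge0.
  apply: (increment_form_cvg_le mOm mK measurableT md cvgd).
  exists n => // m /= nm; apply: le_trans (vv n m nm).
  by rewrite /sqnorm leeDr.
have wu n : (sqnorm (w - u n)%R <= (8 * c * 4^-1 ^+ n)%:E)%E.
  have -> : w - u n = (w - v n) + (v n - u n).
    by apply/funext => x; rewrite !fctE /=; ring.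
  have mz : measurable_fun [set: X] (v n - u n) by exact: measurable_funB.
  have z0 : sqnorm (v n - u n) = 0%E.
    apply: null => // x [nOm|Gx]; rewrite !fctE /=.
      by rewrite uOm// vOm// subrr.
    by rewrite vG// subrr.
  have wvV : fin_norm (w - v n).
    split; first exact: measurable_funB.
    exact: le_lt_trans (vw n) (ltry _).
  apply: (le_trans (sqnormD wvV (nullV _ mz z0))); rewrite z0 mule0 adde0.
  have -> : 8 * c * 4^-1 ^+ n = 2 * (4 * c * 4^-1 ^+ n) by ring.
  by rewrite EFinM lee_wpmul2l// lee_fin.
exists w => //; split => //.
have -> : w = 1 *: (w - u 0%N) + u 0%N by rewrite scale1r subrK.
apply: fin_norm_lin => //; split; first exact: measurable_funB.
exact: le_lt_trans (wu 0%N) (ltry _).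
Qed.

Lemma fin_norm0_lin (k : R) u v :
  fin_norm0 u -> fin_norm0 v -> fin_norm0 (k *: u + v).
Proof.
move=> [uV u0] [vV v0]; split; first exact: fin_norm_lin.
by move=> x nOm; rewrite -[LHS]/(k * u x + v x) u0// v0// mulr0 addr0.
Qed.

(** Coercivity converts convergence for the energy to convergence in norm and
back, so completeness for the norm is completeness for the energy. *)
Lemma energy_solution (C : R) f : 0 <= C ->
  (forall v, fin_norm0 v -> ip lam Om v v <= C * energy v v) ->
  sqr_int lam Om f ->
  exists2 u, fin_norm0 u &
    forall v, fin_norm0 v -> energy u v = ip lam Om f v.
Proof.
move=> C0 friedrichs fL.
have sub0 : fin_norm0 `<=` fin_norm by move=> v [].
have psd0 := psd_restrict sub0 fin_norm0_lin energy_psd.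
have vL v : fin_norm0 v -> sqr_int lam Om v by move=> [/fin_norm_sqr_int].
have ff0 := psd_ge0 (ip_psd lam mOm) fL.
apply: (psd_riesz psd0 (M := ip lam Om f f * C) (c := 8 * (C + 2))).
- exists 0; split=> //; split; first exact: measurable_cst.
  rewrite /sqnorm /increment_form integral0_eq; last by move=> x _; rewrite expr0n.
  rewrite add0e integral0_eq ?ltry// => x _; apply: integral0_eq => y _.
  by rewrite subrr mul0r.
- exact: mulr_ge0.
- move=> k u v u0 v0.
  exact: (psd_linear (ip_psd lam mOm) k fL (vL _ u0) (vL _ v0)).
- move=> v v0.
  rewrite (le_trans (psd_cauchy_schwarz (ip_psd lam mOm) fL (vL _ v0)))//.
  by rewrite -mulrA ler_wpM2l// friedrichs.
move=> u u0 u_cauchy.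
have C2 : 0 <= C + 2 by rewrite addr_ge0.
have [|w w0 wu] := fin_norm0_complete C2 u0.
  move=> n m nm; have muV := psd_sub psd0 (u0 n) (u0 m).
  rewrite (sqnormE (sub0 _ muV)) lee_fin.
  have /andP[_] := energy_le_sqnorm (sub0 _ muV); move/le_trans; apply.
  have := friedrichs _ muV; have := u_cauchy n m nm.
  set p := energy _ _; set q := ip _ _ _ _; set e := _ ^+ n => pe qp.
  have : (C + 2) * p <= (C + 2) * e by rewrite ler_wpM2l.
  apply: le_trans; rewrite [leRHS]mulrDl lerD2r; exact: qp.
exists w => // n; have wuV := psd_sub psd0 (u0 n) w0.
have /andP[ew _] := energy_le_sqnorm (sub0 _ wuV).
rewrite (le_trans ew)// -lee_fin -sqnormE ?wu//; exact: sub0.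
Qed.

End energy_space.

(** * Kernels on Euclidean space *)

Section kernel_facts.
Variables (R : realType) (d : nat).
Local Notation Rd := 'rV[R]_d.
Variable (K : ndkernel R d).

Lemma measurable_fst_borel :
  measurable_fun [set: borel (Rd * Rd)] (fst : Rd * Rd -> borel Rd).
Proof.
apply: (@measurable_fun_borel (Rd * Rd)%type _ Rd fst).
by apply/continuousP => z; exact: cvg_fst.
Qed.

Lemma measurable_snd_borel :
  measurable_fun [set: borel (Rd * Rd)] (snd : Rd * Rd -> borel Rd).
Proof.
apply: (@measurable_fun_borel (Rd * Rd)%type _ Rd snd).
by apply/continuousP => z; exact: cvg_snd.
Qed.

(** Non-degeneracy concerns nonnegative functions of both variables, integrated
over the whole space; signs are handled by positive and negative parts, and D by
its indicator as a function of the second variable. *)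
Lemma measurable_kernel_integral (f : Rd * Rd -> R) (D : set (borel Rd)) :
  measurable_fun [set: borel (Rd * Rd)] f -> measurable D ->
  measurable_fun [set: borel Rd] (fun x => \int[K x]_(y in D) (f (x, y))%:E)%E.
Proof.
move=> mf mD.
have pos (g : Rd * Rd -> R) : measurable_fun [set: borel (Rd * Rd)] g ->
    (forall z, 0 <= g z) ->
    measurable_fun [set: borel Rd] (fun x => \int[K x]_(y in D) (g (x, y))%:E)%E.
  move=> mg g0.
  have -> : (fun x => \int[K x]_(y in D) (g (x, y))%:E)%E =
      (fun x => \int[K x]_y (g (x, y) * \1_D (x, y).2)%:E)%E.
    apply/funext => x; rewrite integral_mkcond; apply: eq_integral => y _.
    by rewrite patchE indicE; case: (y \in D); rewrite ?mulr1 ?mulr0.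
  apply: (@ndkernelP R d K (fun z => g z * \1_D z.2)) => [z|].
    by rewrite mulr_ge0.
  apply: measurable_funM => //.
  have mI : measurable_fun [set: borel Rd] (\1_D : borel Rd -> R).
    exact: measurable_indic.
  exact: (measurableT_comp mI measurable_snd_borel).
have -> : (fun x => \int[K x]_(y in D) (f (x, y))%:E)%E =
  (fun x => \int[K x]_(y in D) (f^\+ (x, y))%:E -
            \int[K x]_(y in D) (f^\- (x, y))%:E)%E.
  by apply/funext => x; rewrite integralE; congr (_ - _)%E;
    apply: eq_integral => y _; rewrite ?funeposE ?funenegE EFin_max.
apply: emeasurable_funB; apply: pos.
- exact: measurable_funrpos.
- by move=> z; exact: funrpos_ge0.
- exact: measurable_funrneg.
- by move=> z; exact: funrneg_ge0.
Qed.

Lemma measurable_increment_integral (u v : borel Rd -> R) (D : set (borel Rd)) :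
  measurable_fun setT u -> measurable_fun setT v -> measurable D ->
  measurable_fun setT
    (fun x => \int[K x]_(y in D) ((u x - u y) * (v x - v y))%:E)%E.
Proof.
move=> mu mv mD.
have mdiff (w : borel Rd -> R) : measurable_fun setT w ->
    measurable_fun [set: borel (Rd * Rd)] (fun z : Rd * Rd => w z.1 - w z.2).
  move=> mw; apply: measurable_funB; apply: (measurableT_comp mw).
    exact: measurable_fst_borel.
  exact: measurable_snd_borel.
apply: (@measurable_kernel_integral
  (fun z => (u z.1 - u z.2) * (v z.1 - v z.2))) => //.
by apply: measurable_funM; exact: mdiff.
Qed.

(** Symmetry of the kernel evaluated at [R^d x N], whose K (x) lambda measure is an
integral over the null set N. *)
Lemma symmetric_kernel_null (lam : {measure set (borel Rd) -> \bar R})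
    (N : set (borel Rd)) : symmetric_kernel lam K -> measurable N ->
  lam N = 0%E -> \forall x \ae lam, K x N = 0%E.
Proof.
move=> sym mN N0.
have mM : measurable ((snd : Rd * Rd -> borel Rd) @^-1` N : set (borel (Rd * Rd))).
  by rewrite -[X in measurable X]setTI; exact: measurable_snd_borel.
have KN0 : (\int[lam]_x K x N = 0)%E.
  transitivity (prod_left lam K ((snd : Rd * Rd -> borel Rd) @^-1` N)).
    apply: eq_integral => x _.
    by rewrite -[X in K x X]setIT -integral_indic.
  rewrite sym// -[RHS](@integral0 _ _ _ lam setT).
  apply: ae_eq_integral => //.
    have := @measurable_kernel_integral (fun z => \1_N z.1) setT.
    apply => //.
    have mI : measurable_fun [set: borel Rd] (\1_N : borel Rd -> R).
      exact: measurable_indic.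
    exact: (measurableT_comp mI measurable_fst_borel).
  exists N; split => // y /= /not_implyP[_ yN0]; apply: contrapT => Ny.
  apply: yN0; apply: integral0_eq => x _.
  by rewrite indicE memNset.
have := measurable_kernel K N mN => mKN.
have : (\int[lam]_x `|K x N| = 0)%E.
  by rewrite -[RHS]KN0; apply: eq_integral => x _; rewrite gee0_abs.
move/(ae_eq_integral_abs lam measurableT mKN).
by apply: filterS => x /(_ I).
Qed.

End kernel_facts.

(** * Weak solutions *)

Section weak_solutions.
Local Open Scope quotient_scope.
Variables (R : realType) (d : nat).
Local Notation Rd := 'rV[R]_d.
Variables (lam : {measure set (borel Rd) -> \bar R}) (K : ndkernel R d).
Variables (Om : set Rd) (oOm : open Om).

Local Notation mOm := (open_borel oOm).
Local Notation mK := (@measurable_increment_integral R d K).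

Local Notation sq := (@sqnorm _ (borel Rd) R lam K Om).
Local Notation fin := (@fin_norm _ (borel Rd) R lam K Om).
Local Notation fin0 := (@fin_norm0 _ (borel Rd) R lam K Om).
Local Notation en := (@energy _ (borel Rd) R lam K Om).
Local Notation ipL := (@ip _ (borel Rd) R lam Om).
Local Notation Vt := (calVtype lam K oOm).
Local Notation Vs := (Vspace lam K oOm).

Lemma calV_fin_norm (v : Vt) : fin v.
Proof.
have := calV_funP v; rewrite inE => -[mv vlty].
exact: (FinNorm mv vlty).
Qed.

Lemma fin_norm_calV (v : Rd -> R) : fin v -> v \in calV lam K oOm.
Proof. by move=> [mv vlty]; apply/asboolP; exact: (conj mv vlty). Qed.

Lemma energy_formE (u v : Vs) :
  energy_form u v = (en (u : Rd -> R) (v : Rd -> R))%:E.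
Proof. exact: (energyE mOm mK (calV_fin_norm _) (calV_fin_norm _)). Qed.

Lemma normVE (u : Vs) : normV u = Num.sqrt (norm_form lam K Om u u).
Proof.
rewrite /normV; congr Num.sqrt.
have h : sq u = _ := sqnormE mOm mK (calV_fin_norm (repr u)).
exact: (congr1 fine h).
Qed.

Lemma int_mul_ipE (f : borel Rd -> R) (v : Vs) : sqr_int lam Om f ->
  (\int[lam]_(x in Om) (f x * v x)%:E = (ipL f (v : Rd -> R))%:E)%E.
Proof.
move=> fL; exact: (ipE mOm fL (fin_norm_sqr_int (calV_fin_norm (repr v)))).
Qed.

(** Quantities on the quotient are evaluated at chosen representatives; this is
what makes any other representative as good. *)
Lemma sqnorm_repr_pi (v : Vt) :
  sq (calV_fun (repr (\pi_Vs v)) - calV_fun v) = 0%E.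
Proof.
have : repr (\pi_Vs v) == v %[mod Vs] by rewrite reprK.
rewrite -Quotient.idealrBE => /eqP. exact.
Qed.

Lemma sqnorm_repr_sub (u v : Vs) :
  sq (calV_fun (repr (u - v)) - (calV_fun (repr u) - calV_fun (repr v))) = 0%E.
Proof.
have := sqnorm_repr_pi (repr u - repr v).
have -> : \pi_Vs (repr u - repr v) = \pi_Vs (repr u) - \pi_Vs (repr v).
  exact: raddfB.
rewrite !reprK; exact.
Qed.

Lemma energy_repr (u v : Vs) (u' v' : Vt) : u = \pi_Vs u' -> v = \pi_Vs v' ->
  energy_form u v = (en (calV_fun u') (calV_fun v'))%:E.
Proof.
move=> -> ->; rewrite energy_formE; congr EFin.
exact: (energy_congr mOm mK (calV_fin_norm _) (calV_fin_norm _)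
  (calV_fin_norm _) (calV_fin_norm _) (sqnorm_repr_pi u') (sqnorm_repr_pi v')).
Qed.

Lemma ip_repr (f : borel Rd -> R) (v : Vs) (v' : Vt) : sqr_int lam Om f ->
  v = \pi_Vs v' -> ipL f (v : Rd -> R) = ipL f (calV_fun v').
Proof.
move=> fL ->; exact: (ip_congr mOm mK fL (calV_fin_norm _) (calV_fin_norm _)
  (sqnorm_repr_pi v')).
Qed.

Lemma V0P (z : Vs) : V0 z -> exists2 v : Vt, fin0 v & z = \pi_Vs v.
Proof.
move=> [v v0 <-]; exists v => //.
exact: (conj (calV_fin_norm v) v0).
Qed.

Lemma V0_sub (u v : Vs) : V0 u -> V0 v -> V0 (u - v).
Proof.
move=> [u' u0 <-] [v' v0 <-]; exists (u' - v').
  move=> x nOm; have := u0 x nOm; have := v0 x nOm.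
  rewrite -[calV_fun (u' - v') x]/(calV_fun u' x - calV_fun v' x) => -> ->.
  exact: subrr.
exact: raddfB.
Qed.

Lemma normV_eq0 (z : Vs) : normV z = 0 -> z = 0.
Proof.
move=> z0.
have zV := calV_fin_norm (repr z).
have rz0 : norm_form lam K Om (repr z) (repr z) = 0.
  apply/eqP; rewrite eq_le (psd_ge0 (norm_form_psd lam mOm mK) zV) andbT.
  by rewrite -sqrtr_eq0 -normVE; exact/eqP.
have sz0 : sq (calV_fun (repr z)) = 0%E.
  exact: (etrans (sqnormE mOm mK zV) (congr1 EFin rz0)).
have pi0 : \pi_Vs 0 = 0 by exact: raddf0.
rewrite -[z]reprK -pi0; apply/eqP; rewrite -Quotient.idealrBE subr0.
apply/eqP; exact: sz0.
Qed.

(** A weak solution with an arbitrary function as datum, so that differences of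
data need no class in L^2. *)
Definition weak_eq (h : borel Rd -> R) (z : Vs) := V0 z /\
  forall v : Vs, V0 v -> energy_form z v = (\int[lam]_(x in Om) (h x * v x)%:E)%E.

Lemma weak_eq_sub (f g : borel Rd -> R) (u w : Vs) :
  sqr_int lam Om f -> sqr_int lam Om g -> weak_eq f u -> weak_eq g w ->
  weak_eq (g - f) (w - u).
Proof.
move=> fL gL [u0 fu] [w0 gw]; split; first exact: V0_sub.
move=> v v0.
have gfL := psd_sub (ip_psd lam mOm) fL gL.
rewrite (int_mul_ipE v gfL) energy_formE; congr EFin.
have uV := calV_fin_norm (repr u); have wV := calV_fin_norm (repr w).
have vV := calV_fin_norm (repr v); have wuV := calV_fin_norm (repr (w - u)).
have wuV' := psd_sub (energy_psd lam mOm mK) uV wV.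
have v00 : sq (calV_fun (repr v) - calV_fun (repr v)) = 0%E.
  by rewrite subrr; exact: normsq0.
transitivity (en (calV_fun (repr w) - calV_fun (repr u)) (calV_fun (repr v))).
  exact: (energy_congr mOm mK wuV wuV' vV vV (sqnorm_repr_sub w u) v00).
have := fu v v0; have := gw v v0.
rewrite (int_mul_ipE v fL) (int_mul_ipE v gL) !energy_formE => -[gwv] [fuv].
rewrite (psd_diffl (energy_psd lam mOm mK) vV wV uV).
rewrite (psd_diffl (ip_psd lam mOm) (fin_norm_sqr_int vV) gL fL).
exact: (f_equal2 (fun a b => a - b) gwv fuv).
Qed.

Section friedrichs.
Variable C : R.
Hypothesis C_gt0 : 0 < C.
Hypothesis friedrichs : forall v : Vs, V0 v ->
  (\int[lam]_(x in Om) (v x ^+ 2)%:E <= C%:E * energy_form v v)%E.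

Lemma friedrichs_repr (z : Vs) : V0 z -> ipL z z <= C * en z z.
Proof.
move=> z0; have := friedrichs z0; rewrite energy_formE -EFinM.
rewrite (ip_sqrE mOm (fin_norm_sqr_int (calV_fin_norm (repr z)))).
by rewrite lee_fin.
Qed.

Lemma weak_eq_normV (h : borel Rd -> R) (z : Vs) : sqr_int lam Om h ->
  weak_eq h z -> normV z <= (C + 2) * Num.sqrt (ipL h h).
Proof.
move=> hL [z0 hz]; rewrite normVE.
apply: (energy_estimate mOm mK (ltW C_gt0) hL (calV_fin_norm (repr z))).
  exact: friedrichs_repr.
apply: EFin_inj; have := hz z z0.
by rewrite (int_mul_ipE z hL) energy_formE.
Qed.

Lemma weak_eq_unique (h : borel Rd -> R) (z z' : Vs) : sqr_int lam Om h ->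
  weak_eq h z -> weak_eq h z' -> z = z'.
Proof.
move=> hL hz hz'; have := weak_eq_sub hL hL hz' hz.
move/(weak_eq_normV (psd_sub (ip_psd lam mOm) hL hL)).
have -> : ipL (h - h) (h - h) = 0.
  rewrite (psd_diffl (ip_psd lam mOm) (psd_sub (ip_psd lam mOm) hL hL) hL hL).
  exact: subrr.
rewrite sqrtr0 mulr0 => le0; apply/eqP; rewrite -subr_eq0; apply/eqP.
by apply: normV_eq0; apply/eqP; rewrite eq_le le0 sqrtr_ge0.
Qed.

Hypothesis K_sym : symmetric_kernel lam K.
Hypothesis lamOm : (lam Om < +oo)%E.

Lemma weak_eq_exists (h : borel Rd -> R) : sqr_int lam Om h ->
  exists z : Vs, weak_eq h z.
Proof.
move=> hL.
have fried v : fin0 v -> ipL v v <= C * en v v.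
  move=> [vV v0]; pose v' : Vt := CalV (fin_norm_calV vV).
  have zv : V0 (\pi_Vs v') by exists v'.
  have := friedrichs_repr zv.
  have zL := fin_norm_sqr_int (calV_fin_norm (repr (\pi_Vs v'))).
  rewrite (ip_repr zL erefl).
  have vL := fin_norm_sqr_int vV.
  rewrite (psd_sym (ip_psd lam mOm) zL vL) (ip_repr vL erefl).
  have := energy_repr (erefl (\pi_Vs v')) (erefl (\pi_Vs v')).
  by rewrite energy_formE => -[->].
have K_null N : measurable N -> lam N = 0%E -> \forall x \ae lam, K x N = 0%E.
  exact: symmetric_kernel_null.
have [u [uV u0] uh] := energy_solution mOm mK K_null lamOm (ltW C_gt0) fried hL.
pose u' : Vt := CalV (fin_norm_calV uV).
exists (\pi_Vs u'); split; first by exists u'.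
move=> v /V0P[v' v0 vv'].
rewrite (energy_repr erefl vv') (int_mul_ipE v hL); congr EFin.
rewrite (ip_repr hL vv'); exact: (uh _ v0).
Qed.

End friedrichs.

Lemma L2_sqr_int (f : L2 lam oOm) : sqr_int lam Om (f : borel Rd -> R).
Proof.
have mf : measurable_fun [set: borel Rd] (f : borel Rd -> R).
  have mf := measurable_funPT (repr (LebesgueSpace.sort f)).
  by move=> mT Y mY; exact: (mf mT Y mY).
apply: (finite_Lnorm2_sqr_int (mD := mOm) mf).
exact: Lebesgue_finite.
Qed.

Lemma normL2E (f : borel Rd -> R) : sqr_int lam Om f ->
  normL2 lam oOm f = Num.sqrt (ipL f f).
Proof. exact: fine_Lnorm2_mrestr. Qed.

End weak_solutions.

Theorem theorem5p1 (R : realType) (d : nat)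
    (lam : {measure set (borel 'rV[R]_d) -> \bar R})
    (Om : set 'rV[R]_d) (oOm : open Om) (Om_neq0 : Om !=set0)
    (lamOm : (lam Om < +oo)%E)
    (K : ndkernel R d) (K_sym : symmetric_kernel lam K)
    (friedrichs : nonlocal_friedrichs lam K oOm) :
  (exists2 C : R, 0 < C &
     forall f : L2 lam oOm,
       exists2 u : Vspace lam K oOm,
         unique (weak_solution f) u & normV u <= C * normL2 lam oOm f) /\
  (forall (f : L2 lam oOm) (eps : R), 0 < eps ->
     exists2 delta : R, 0 < delta &
       forall g : L2 lam oOm,
         normL2 lam oOm (fun x => (g x : R) - (f x : R)) < delta ->
       forall u w : Vspace lam K oOm,
         weak_solution f u -> weak_solution g w -> normV (w - u) < eps).
Proof.
have [C C0 fried] := friedrichs.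
have C2 : 0 < C + 2 by rewrite addr_gt0.
split.
  exists (C + 2) => // f; have fL := L2_sqr_int f.
  have [u fu] := weak_eq_exists C0 fried K_sym lamOm fL.
  exists u; last by rewrite (normL2E oOm fL); exact: (weak_eq_normV C0 fried fL fu).
  split; first exact: fu.
  by move=> w fw; exact: (weak_eq_unique C0 fried fL fu fw).
move=> f eps eps0; exists (eps / (C + 2)); first exact: divr_gt0.
move=> g fg u w fu gw.
have fL := L2_sqr_int f; have gL := L2_sqr_int g.
have gfL := psd_sub (ip_psd lam (open_borel oOm)) fL gL.
have := weak_eq_normV C0 fried gfL (weak_eq_sub fL gL fu gw).
rewrite -(normL2E oOm gfL); move/le_lt_trans; apply.
rewrite mulrC -ltr_pdivlMr//; exact: fg.
Qed.
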